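(* Let $\mathcal{V}$ be a simple Euclidean Jordan algebra of rank $n$ with unit element $e$, and let $T:\mathcal{V}\to\mathcal{V}$ be a positive linear transformation. Let $p\in\mathcal{V}$ have spectral decomposition $p=p_1e_1+p_2e_2+\cdots+p_ne_n$ (with $\{e_1,\ldots,e_n\}$ a Jordan frame), where the $p_i$ are positive and distinct. Suppose the following conditions hold: (i) $T(e)\underset{w}{\prec}e$, $p\underset{w}{\prec}T(p)$, and $T(p^2)\underset{w}{\prec}p^2$; and (ii) $T(p)$ and $T(p^2)$ operator commute. Then (a) $T$ coincides with an automorphism of $\mathcal{V}$ on $\operatorname{span}\{e_1,e_2,\ldots,e_n\}$; (b) $\lambda(T(x))=\lambda(x)$ for all $x\in\operatorname{span}\{e_1,e_2,\ldots,e_n\}$; and (c) $T$ is doubly stochastic.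
   Context: A Euclidean Jordan algebra is a finite-dimensional real inner product space $(\mathcal{V},\langle\cdot,\cdot\rangle)$ with a bilinear product $(x,y)\mapsto x\circ y$ satisfying $x\circ y=y\circ x$, $x\circ(x^2\circ y)=x^2\circ(x\circ y)$ with $x^2=x\circ x$, and $\langle x\circ y,z\rangle=\langle x,y\circ z\rangle$. It has a unit element $e$ (with $x\circ e=x$ for all $x$). It is simple if it is nonzero and is not a direct sum of two nonzero Euclidean Jordan algebras. Its symmetric cone is $K=\{x\circ x:x\in\mathcal{V}\}$; write $x\ge 0$ when $x\in K$. A nonzero $c$ with $c^2=c$ is an idempotent; it is primitive if it is not the sum of two other (nonzero) idempotents. A Jordan frame is a set $\{e_1,\ldots,e_n\}$ of mutually orthogonal primitive idempotents (equivalently, $e_i\circ e_j=0$ for $i\ne j$) with sum $e$; all Jordan frames have the same number $n$ of elements, called the rank of $\mathcal{V}$. By the spectral decomposition theorem every $x\in\mathcal{V}$ can be written $x=x_1e_1+\cdots+x_ne_n$ with real numbers $x_i$ (the eigenvalues of $x$, which do not depend on the decomposition) and some Jordan frame $\{e_1,\ldots,e_n\}$. The trace is $\operatorname{tr}(x)=x_1+\cdots+x_n$, and $\lambda(x)\in\mathbb{R}^n$ denotes the vector of eigenvalues of $x$ in decreasing order. For $a\in\mathcal{V}$ let $L_a(x):=a\circ x$. Elements $a,b$ operator commute if $L_aL_b=L_bL_a$. A linear transformation $T:\mathcal{V}\to\mathcal{V}$ is positive if $x\ge0\Rightarrow T(x)\ge0$; unital if $T(e)=e$; trace-preserving if $\operatorname{tr}(T(x))=\operatorname{tr}(x)$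 for all $x$; doubly stochastic if it is positive, unital and trace-preserving. An automorphism of $\mathcal{V}$ is a bijective linear $\phi:\mathcal{V}\to\mathcal{V}$ with $\phi(x\circ y)=\phi(x)\circ\phi(y)$ for all $x,y$. For $u,v\in\mathbb{R}^n$, $u^\downarrow$ is the decreasing rearrangement of $u$; $u\underset{w}{\prec}v$ means $\sum_{i=1}^k u_i^\downarrow\le\sum_{i=1}^k v_i^\downarrow$ for all $k=1,\ldots,n$. For $x,y\in\mathcal{V}$, $x\underset{w}{\prec}y$ means $\lambda(x)\underset{w}{\prec}\lambda(y)$ in $\mathbb{R}^n$. *)

(* Defs.v *)
From mathcomp Require Import all_boot all_order all_algebra.
From mathcomp Require Import boolp classical_sets reals.

Set Implicit Arguments.
Unset Strict Implicit.
Unset Printing Implicit Defensive.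

Import Order.TTheory GRing.Theory Num.Theory.
Local Open Scope ring_scope.

(* Linearity in the second argument of [jmul] and [jinner] follows from
   commutativity, resp. symmetry.  The unit is not derivable from the other
   axioms (the zero product satisfies them all), so it is part of the
   structure. *)
Record euclidean_jordan_algebra (R : realType) (V : vectType R) := EJA {
  jmul : V -> V -> V;
  jinner : V -> V -> R;
  jone : V;
  jmul_linearl : forall y, linear (jmul^~ y);
  jmulC : forall x y, jmul x y = jmul y x;
  jmul_jordan : forall x y,
    jmul x (jmul (jmul x x) y) = jmul (jmul x x) (jmul x y);
  jinner_linearl : forall y, scalar (jinner^~ y);
  jinnerC : forall x y, jinner x y = jinner y x;
  jinner_gt0 : forall x, x != 0 -> 0 < jinner x x;
  jmul_self_adjoint : forall x y z,
    jinner (jmul x y) z = jinner x (jmul y z);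
  jmulx1 : forall x, jmul x jone = x
}.

Definition subalgebra (R : realType) (V : vectType R)
    (J : euclidean_jordan_algebra V) (U : {vspace V}) : Prop :=
  forall x y, x \in U -> y \in U -> jmul J x y \in U.

(* Internal direct sum: each summand inherits the product and inner product
   of V, and its unit is the component of [jone J] in it. *)
Definition direct_sum_decomposition (R : realType) (V : vectType R)
    (J : euclidean_jordan_algebra V) (U W : {vspace V}) : Prop :=
  [/\ subalgebra J U /\ subalgebra J W,
      (U + W = fullv)%VS /\ (U :&: W = 0)%VS,
      (forall x y, x \in U -> y \in W -> jmul J x y = 0) &
      (forall x y, x \in U -> y \in W -> jinner J x y = 0)].

Definition simple_EJA (R : realType) (V : vectType R)
    (J : euclidean_jordan_algebra V) : Prop :=
  (exists x : V, x != 0) /\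
  ~ (exists U W : {vspace V},
       [/\ U != 0%VS, W != 0%VS & direct_sum_decomposition J U W]).

(* Membership in the symmetric cone, i.e. x >= 0. *)
Definition in_cone (R : realType) (V : vectType R)
    (J : euclidean_jordan_algebra V) (x : V) : Prop :=
  exists y, x = jmul J y y.

Definition idempotent_elt (R : realType) (V : vectType R)
    (J : euclidean_jordan_algebra V) (c : V) : Prop :=
  c != 0 /\ jmul J c c = c.

Definition primitive_idempotent (R : realType) (V : vectType R)
    (J : euclidean_jordan_algebra V) (c : V) : Prop :=
  idempotent_elt J c /\
  ~ (exists a b, [/\ idempotent_elt J a, idempotent_elt J b & c = a + b]).

(* The elements of a frame are nonzero and mutually orthogonal, hence
   distinct, so a family indexed by 'I_n is a set of n elements. *)
Definition jordan_frame (R : realType) (V : vectType R)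
    (J : euclidean_jordan_algebra V) (n : nat) (E : 'I_n -> V) : Prop :=
  [/\ forall i, primitive_idempotent J (E i),
      forall i j, i != j -> jmul J (E i) (E j) = 0 &
      \sum_(i < n) E i = jone J].

(* All Jordan frames have the same number of elements, so one frame
   determines the rank. *)
Definition has_rank (R : realType) (V : vectType R)
    (J : euclidean_jordan_algebra V) (n : nat) : Prop :=
  exists E : 'I_n -> V, jordan_frame J E.

Definition spectral_decomposition (R : realType) (V : vectType R)
    (J : euclidean_jordan_algebra V) (n : nat)
    (x : V) (r : 'I_n -> R) (E : 'I_n -> V) : Prop :=
  jordan_frame J E /\ x = \sum_(i < n) r i *: E i.

(* lambda(x) for J of rank n: the decreasing vector of coefficients in a
   spectral decomposition of x (unique, by the spectral theorem).  The default
   value 0 of [xget] is only reached when n is not the rank of J. *)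
Definition eigenvalues (R : realType) (V : vectType R)
    (J : euclidean_jordan_algebra V) (n : nat) (x : V) : n.-tuple R :=
  xget [tuple 0 | i < n]
    [set l : n.-tuple R | sorted (fun a b : R => b <= a) l /\
       exists E : 'I_n -> V, spectral_decomposition J x (tnth l) E]%classic.

Definition jtrace (R : realType) (V : vectType R)
    (J : euclidean_jordan_algebra V) (n : nat) (x : V) : R :=
  \sum_(i < n) tnth (eigenvalues J n x) i.

Definition operator_commute (R : realType) (V : vectType R)
    (J : euclidean_jordan_algebra V) (a b : V) : Prop :=
  forall x, jmul J a (jmul J b x) = jmul J b (jmul J a x).

Definition positive_map (R : realType) (V : vectType R)
    (J : euclidean_jordan_algebra V) (T : V -> V) : Prop :=
  forall x, in_cone J x -> in_cone J (T x).

Definition unital_map (R : realType) (V : vectType R)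
    (J : euclidean_jordan_algebra V) (T : V -> V) : Prop :=
  T (jone J) = jone J.

Definition trace_preserving (R : realType) (V : vectType R)
    (J : euclidean_jordan_algebra V) (n : nat) (T : V -> V) : Prop :=
  forall x, jtrace J n (T x) = jtrace J n x.

Definition doubly_stochastic (R : realType) (V : vectType R)
    (J : euclidean_jordan_algebra V) (n : nat) (T : V -> V) : Prop :=
  [/\ positive_map J T, unital_map J T & trace_preserving J n T].

Definition jordan_automorphism (R : realType) (V : vectType R)
    (J : euclidean_jordan_algebra V) (phi : {linear V -> V}) : Prop :=
  bijective phi /\ forall x y, phi (jmul J x y) = jmul J (phi x) (phi y).

Definition decreasing_rearrangement (R : realType) (n : nat)
    (u : n.-tuple R) : n.-tuple R :=
  [tuple of sort (fun a b : R => b <= a) u].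

Definition weakly_majorized (R : realType) (n : nat)
    (u v : n.-tuple R) : Prop :=
  forall k : nat, (1 <= k <= n)%N ->
    \sum_(i < n | (i < k)%N) tnth (decreasing_rearrangement u) i <=
    \sum_(i < n | (i < k)%N) tnth (decreasing_rearrangement v) i.

Definition jweakly_majorized (R : realType) (V : vectType R)
    (J : euclidean_jordan_algebra V) (n : nat) (x y : V) : Prop :=
  weakly_majorized (eigenvalues J n x) (eigenvalues J n y).

(* Main.v *)
(** Let N be the common norm of the primitive idempotents (V is simple), so that
    tr x = <x,e>/N, and diagonalize T p = sum q_i f_i. The matrix
    a_ij = <T e_j, f_i>/N is nonnegative, has row sums at most 1 because T e <= e, and
    satisfies q_i = sum_j a_ij p_j; put s_i = sum_j a_ij p_j^2. Then q_i^2 <= s_i and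
    sum s_i = tr T(p^2) <= sum p_i^2. On the other hand, by Abel summation, p <_w q
    with sum q_i^2 <= sum p_i^2 forces q to be a permutation of p. Hence s_i = q_i^2,
    the variance sum_j a_ij (p_j - q_i)^2 vanishes, and a is a permutation matrix
    since the p_j are distinct. As T e_j >= 0 is orthogonal to all f_i but one, it
    equals that f_i: T maps the frame (e_j) to a frame.

    Two frames of a simple algebra are related by a product of the automorphisms
    8 L_c^2 - 8 L_c + 1, where c is an idempotent halfway between two primitive
    idempotents. Trace preservation holds because the functional <T x, T e_i> is
    positive and vanishes at e_j for j <> i, hence equals <x, e_i>. *)
Require Import Defs.
From HB Require Import structures.
From mathcomp Require Import all_boot all_order all_algebra.
From mathcomp Require Import boolp classical_sets reals.
From mathcomp Require Import perm complex ring lra.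

Set Implicit Arguments.
Unset Strict Implicit.
Unset Printing Implicit Defensive.

Import Order.TTheory GRing.Theory Num.Theory.
Local Open Scope ring_scope.

(** * Factors of real polynomials, and spans *)

Lemma real_poly_factor (R : rcfType) (q : {poly R}) : (1 < size q)%N ->
  (exists r s, q = s * ('X - r%:P)) \/
  (exists a b s, b != 0 /\ q = s * (('X - a%:P) ^+ 2 + (b ^+ 2)%:P)).
Proof.
move=> q1; pose toC := real_complex R.
have /closed_rootP[[a b] qz] : size (map_poly toC q) != 1%N.
  by rewrite size_map_poly gtn_eqF.
have [b0|b0] := eqVneq b 0.
  left; move: qz; rewrite b0 -[Complex a 0]/(toC a) fmorph_root.
  by move=> /factor_theorem[s ->]; exists a, s.
(* A non-real root comes with its conjugate. Divisibility by the real quadratic is tested over the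
   complex numbers, where it splits into two coprime linear factors. *)
right; exists a, b.
suff : ('X - a%:P) ^+ 2 + (b ^+ 2)%:P %| q by move=> /dvdpP[s ->]; exists s.
rewrite -(dvdp_map toC).
have -> : map_poly toC (('X - a%:P) ^+ 2 + (b ^+ 2)%:P) =
    \prod_(z <- [:: Complex a b; Complex a (- b)]) ('X - z%:P).
  rewrite rmorphXn rmorphD !rmorphXn rmorphB /= map_polyX !map_polyC /=.
  have DE (u v : R) : (Complex u v)%:P = (toC u)%:P + (toC v)%:P * ('i%C)%:P.
    rewrite -polyCM -polyCD; congr _%:P; apply/eqP.
    by rewrite eq_complex /= !(mulr0, mulr1, subr0, addr0, add0r) !eqxx.
  have NE : (toC (- b))%:P = - (toC b)%:P.
    by rewrite -polyCN; congr _%:P; exact: (rmorphN (real_complex R)).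
  have i2 : 'i%C * 'i%C = -1 :> R[i].
    by apply/eqP; rewrite eq_complex /= !(mulr0, mulr1, sub0r, addr0, oppr0) !eqxx.
  have ii : ('i%C)%:P ^+ 2 = - 1%:P :> {poly R[i]}.
    by rewrite expr2 -polyCM i2 polyCN.
  rewrite !big_cons big_nil mulr1 (DE a b) (DE a (- b)) NE.
  move: (toC a)%:P (toC b)%:P ('i%C)%:P ii => A B I ii.
  by rewrite mulNr !opprD opprK !addrA -subr_sqr exprMn ii mulrN polyC1 mulr1 opprK.
apply: uniq_roots_dvdp; rewrite /= ?andbT.
  rewrite qz /=.
  have -> : map_poly toC q = map_poly conjc (map_poly toC q).
    by rewrite -map_poly_comp; apply: eq_map_poly => u; rewrite /= oppr0.
  by rewrite complex_root_conj /= opprK.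
rewrite /diff_roots mulrC eqxx unitfE subr_eq0 eq_complex /= negb_and.
by rewrite eqxx eq_sym -addr_eq0 -mulr2n mulrn_eq0 (negPf b0).
Qed.

Lemma mem_span_tuple (K : fieldType) (W : vectType K) n (E : 'I_n -> W) x :
  x \in <<[tuple E i | i < n]>>%VS ->
  exists k : 'I_n -> K, x = \sum_i k i *: E i.
Proof.
move=> /coord_span ->; exists (fun i => coord [tuple E i | i < n] i x).
by apply: eq_bigr => i _; rewrite -tnth_nth tnth_mktuple.
Qed.

(** * Weak majorization of real vectors *)

Section WeakMajorization.
Context (R : realType).
Local Notation geR := (fun a b : R => b <= a).

Lemma geR_total : total geR.
Proof. by move=> u v; exact: le_total. Qed.

Lemma geR_anti : antisymmetric geR.
Proof. by move=> u v /andP[uv vu]; apply: le_anti; rewrite uv vu. Qed.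

Lemma geR_trans : transitive geR.
Proof. by move=> u v w uv wu; apply: le_trans wu uv. Qed.

Lemma decreasing_rearrangement_sorted n (t : n.-tuple R) :
  sorted geR (decreasing_rearrangement t).
Proof. exact: sort_sorted geR_total _. Qed.

Lemma decreasing_rearrangement_id n (t : n.-tuple R) :
  sorted geR t -> decreasing_rearrangement t = t.
Proof. by move=> ts; apply: val_inj; apply: sorted_sort geR_trans _ ts. Qed.

Lemma sum_decreasing_rearrangement n (t : n.-tuple R) (f : R -> R) :
  \sum_i f (tnth (decreasing_rearrangement t) i) = \sum_i f (tnth t i).
Proof.
rewrite -!(big_tuple _ _ _ predT f) /=.
by apply: perm_big; rewrite perm_sort.
Qed.

Lemma weakly_majorized_sum n (u v : n.-tuple R) : weakly_majorized u v ->
  \sum_i tnth u i <= \sum_i tnth v i.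
Proof.
case: n u v => [|n] u v uv; first by rewrite !big_ord0.
have full (t : n.+1.-tuple R) :
    \sum_(i < n.+1 | (i < n.+1)%N) tnth t i = \sum_i tnth t i.
  by apply: eq_bigl => i; rewrite ltn_ord.
have := uv n.+1; rewrite leqnn => /(_ isT).
by rewrite !full !(sum_decreasing_rearrangement _ id).
Qed.

Lemma weakly_majorized_max n (u v : n.-tuple R) (M : R) :
  weakly_majorized u v -> (forall i, tnth v i <= M) -> forall i, tnth u i <= M.
Proof.
case: n u v => [|n] u v uv vM i; first by case: i.
have := uv 1 isT; rewrite !(big_pred1 ord0) => [uv0|j|j]; last 2 first.
- by rewrite /= -val_eqE ltnS leqn0.
- by rewrite /= -val_eqE ltnS leqn0.
have memdr (t : n.+1.-tuple R) x : (x \in decreasing_rearrangement t) = (x \in t).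
  by rewrite mem_sort.
have /tnthP[j ->] : tnth u i \in decreasing_rearrangement u by rewrite memdr mem_tnth.
have /tnthP[l vl] : tnth (decreasing_rearrangement v) ord0 \in v by rewrite -memdr mem_tnth.
apply: le_trans (vM l); rewrite -vl; apply: le_trans uv0.
rewrite !(tnth_nth 0).
apply: (sorted_leq_nth geR_trans _ 0 (decreasing_rearrangement_sorted u)) => //.
- by rewrite inE size_tuple.
- by rewrite inE size_tuple ltn_ord.
Qed.

(* Abel summation. *)
Lemma ge0_sum_decreasing (u w : nat -> R) n : (forall i, u i.+1 <= u i) ->
  (forall k, (k <= n)%N -> 0 <= \sum_(i < k) w i) ->
  u n * (\sum_(i < n) w i) <= \sum_(i < n) u i * w i.
Proof.
move=> ud; elim: n => [|n IH] W; first by rewrite !big_ord0 mulr0.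
have {}IH := IH (fun k kn => W k (leqW kn)).
apply: (@le_trans _ _ (u n * \sum_(i < n.+1) w i)).
  by rewrite ler_wpM2r // W.
by rewrite !big_ord_recr /= mulrDr lerD2r.
Qed.

(** The squared distance of [s] and [t] is the difference of their sums of squares minus twice the
    sum of s_i (t_i - s_i). Abel summation makes the latter nonnegative, because the partial sums of
    t - s are. *)
Lemma weakly_majorized_sqr_eq n (s t : n.-tuple R) : sorted geR s ->
  sorted geR t -> (forall i, 0 <= tnth s i) -> weakly_majorized s t ->
  \sum_i tnth t i ^+ 2 <= \sum_i tnth s i ^+ 2 -> s = t.
Proof.
move=> ss ts s0 st t2.
(* The default [0] continues [s] past [n]. Nonnegative entries keep the extension decreasing, and
   its value [0] at [n] later removes the boundary term of the Abel summation. *)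
have dec i : nth 0 s i.+1 <= nth 0 s i.
  have [ilt|ige] := ltnP i.+1 n; first by apply: (sortedP 0 ss); rewrite size_tuple.
  rewrite [X in X <= _]nth_default ?size_tuple //.
  have [ilt|ige'] := ltnP i n; first by have := s0 (Ordinal ilt); rewrite (tnth_nth 0).
  by rewrite nth_default ?size_tuple.
have W k : (k <= n)%N -> 0 <= \sum_(i < k) (nth 0 t i - nth 0 s i).
  case: k => [|k] kn; first by rewrite big_ord0.
  rewrite sumrB subr_ge0; have := st k.+1; rewrite kn => /(_ isT).
  rewrite !decreasing_rearrangement_id // !(big_ord_widen n (fun i => nth 0 _ i) kn).
  by congr (_ <= _); apply: eq_bigr => i _; rewrite (tnth_nth 0).
have := ge0_sum_decreasing (w := fun i => nth 0 t i - nth 0 s i) dec W.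
rewrite nth_default ?size_tuple // mul0r => A.
have : \sum_i (tnth t i - tnth s i) ^+ 2 <= 0.
  have -> : \sum_i (tnth t i - tnth s i) ^+ 2 = \sum_i tnth t i ^+ 2 -
      \sum_i tnth s i ^+ 2 - 2 * \sum_(i < n) nth 0 s i * (nth 0 t i - nth 0 s i).
    rewrite mulr_sumr -!sumrB; apply: eq_bigr => i _.
    by rewrite !(tnth_nth 0); ring.
  by rewrite -[X in X <= _]addr0; lra.
move=> le0; apply: eq_from_tnth => i; apply/eqP; rewrite eq_sym -subr_eq0 -sqrf_eq0.
have := psumr_eq0P (fun i _ => sqr_ge0 (tnth t i - tnth s i)) _ (i := i) isT.
by move=> -> //; apply: le_anti; rewrite le0 sumr_ge0 // => j _; exact: sqr_ge0.
Qed.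

End WeakMajorization.

(** * Bilinearity and the linearized Jordan identity *)

Section EuclideanJordanAlgebra.
Context (R : realType) (V : vectType R) (J : euclidean_jordan_algebra V).
Implicit Types (x y z w a b c d f g : V) (k r s t : R).

Local Notation "x ∘ y" := (jmul J x y) (at level 40, left associativity).
Local Notation "⟨ x , y ⟩" := (jinner J x y) (at level 0, x, y at level 99).
Local Notation "'e" := (jone J) (at level 0).

Lemma jmulDl x y z : (x + y) ∘ z = x ∘ z + y ∘ z.
Proof. by have := jmul_linearl J z 1 x y; rewrite /= !scale1r. Qed.

Lemma jmul0x x : 0 ∘ x = 0.
Proof. by apply: (addrI (0 ∘ x)); rewrite -jmulDl !addr0. Qed.

Lemma jmulZl k x y : (k *: x) ∘ y = k *: (x ∘ y).
Proof. by have := jmul_linearl J y k x 0; rewrite /= jmul0x !addr0. Qed.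

Lemma jmulNl x y : (- x) ∘ y = - (x ∘ y).
Proof. by rewrite -scaleN1r jmulZl scaleN1r. Qed.

Lemma jmulBl x y z : (x - y) ∘ z = x ∘ z - y ∘ z.
Proof. by rewrite jmulDl jmulNl. Qed.

Lemma jmulDr x y z : x ∘ (y + z) = x ∘ y + x ∘ z.
Proof. by rewrite jmulC jmulDl !(jmulC J x). Qed.

Lemma jmulx0 x : x ∘ 0 = 0.
Proof. by rewrite jmulC jmul0x. Qed.

Lemma jmulZr k x y : x ∘ (k *: y) = k *: (x ∘ y).
Proof. by rewrite jmulC jmulZl jmulC. Qed.

Lemma jmulNr x y : x ∘ (- y) = - (x ∘ y).
Proof. by rewrite jmulC jmulNl jmulC. Qed.

Lemma jmulBr x y z : x ∘ (y - z) = x ∘ y - x ∘ z.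
Proof. by rewrite jmulDr jmulNr. Qed.

Definition jmulE := (jmulDl, jmulDr, jmulNl, jmulNr, jmulZl, jmulZr).

Fact jmul_linear a : linear (jmul J a).
Proof. by move=> k x y; rewrite jmulDr jmulZr. Qed.
HB.instance Definition _ a := GRing.isLinear.Build R V V *:%R (jmul J a)
  (jmul_linear a).

Lemma ipDl x y z : ⟨x + y, z⟩ = ⟨x, z⟩ + ⟨y, z⟩.
Proof. by have := jinner_linearl J z 1 x y; rewrite /= scale1r mul1r. Qed.

Lemma ip0x x : ⟨0, x⟩ = 0.
Proof. by apply: (addrI ⟨0, x⟩); rewrite -ipDl !addr0. Qed.

Lemma ipZl k x y : ⟨k *: x, y⟩ = k * ⟨x, y⟩.
Proof. by have := jinner_linearl J y k x 0; rewrite /= ip0x !addr0. Qed.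

Lemma ipNl x y : ⟨- x, y⟩ = - ⟨x, y⟩.
Proof. by rewrite -scaleN1r ipZl mulN1r. Qed.

Lemma ipDr x y z : ⟨x, y + z⟩ = ⟨x, y⟩ + ⟨x, z⟩.
Proof. by rewrite jinnerC ipDl !(jinnerC J x). Qed.

Lemma ipx0 x : ⟨x, 0⟩ = 0.
Proof. by rewrite jinnerC ip0x. Qed.

Lemma ipZr k x y : ⟨x, k *: y⟩ = k * ⟨x, y⟩.
Proof. by rewrite jinnerC ipZl jinnerC. Qed.

Lemma ipNr x y : ⟨x, - y⟩ = - ⟨x, y⟩.
Proof. by rewrite jinnerC ipNl jinnerC. Qed.

Lemma ip_suml (I : Type) (s : seq I) (P : pred I) (F : I -> V) y :
  ⟨\sum_(i <- s | P i) F i, y⟩ = \sum_(i <- s | P i) ⟨F i, y⟩.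
Proof. by apply: (big_morph (jinner J ^~ y)) => [? ?|]; rewrite (ipDl, ip0x). Qed.

Lemma ip_sumr (I : Type) (s : seq I) (P : pred I) (F : I -> V) y :
  ⟨y, \sum_(i <- s | P i) F i⟩ = \sum_(i <- s | P i) ⟨y, F i⟩.
Proof. by rewrite jinnerC ip_suml; apply: eq_bigr => i _; rewrite jinnerC. Qed.

Lemma jmul_suml (I : Type) (s : seq I) (P : pred I) (F : I -> V) y :
  (\sum_(i <- s | P i) F i) ∘ y = \sum_(i <- s | P i) (F i ∘ y).
Proof. by apply: (big_morph (jmul J ^~ y)) => [? ?|]; rewrite (jmulDl, jmul0x). Qed.

Definition ipE := (ipDl, ipNl, ipZl, ip0x).
Definition ipEr := (ipDr, ipNr, ipZr, ipx0).

Lemma ip_eq0 x : (⟨x, x⟩ == 0) = (x == 0).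
Proof.
apply/eqP/eqP => [|->]; last exact: ip0x.
by move=> x0; apply/eqP; apply/negPn/negP => /(jinner_gt0 J); rewrite x0 ltxx.
Qed.

Lemma ip_ge0 x : 0 <= ⟨x, x⟩.
Proof. by have [->|/(jinner_gt0 J)/ltW//] := eqVneq x 0; rewrite ip0x. Qed.

Lemma ip_ext x y : (forall z, ⟨x, z⟩ = ⟨y, z⟩) -> x = y.
Proof.
move=> xy; apply/eqP; rewrite -subr_eq0 -ip_eq0.
by rewrite ipDl ipNl xy subrr.
Qed.

(* Linear identities in [V], from linear hypotheses in [V], by pairing both sides with
   an arbitrary vector. *)
Ltac vlin :=
  let z := fresh "z" in apply: ip_ext => z;
  repeat match goal with H : ?u = ?v |- _ =>
    apply (f_equal (fun t : V => jinner J t z)) in H; rewrite ?ipE in H end;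
  rewrite ?ipE; lra.

(** Full polarization of the Jordan identity in its cubic variable, by inclusion-exclusion over the
    partial sums of [x], [y], [z]. *)
Lemma jmul_linearized x y z w :
  x ∘ ((y ∘ z) ∘ w) + y ∘ ((z ∘ x) ∘ w) + z ∘ ((x ∘ y) ∘ w) =
  (y ∘ z) ∘ (x ∘ w) + (z ∘ x) ∘ (y ∘ w) + (x ∘ y) ∘ (z ∘ w).
Proof.
have G u := jmul_jordan J u w.
have := (G (x + y + z), G (x + y), G (y + z), G (x + z), G x, G y, G z).
rewrite !jmulE !(jmulC J y x) !(jmulC J z x) !(jmulC J z y).
case=> [] [] [] [] [] [] H1 H2 H3 H4 H5 H6 H7; clear G.
vlin.
Qed.

Lemma jmul1x x : 'e ∘ x = x.
Proof. by rewrite jmulC jmulx1. Qed.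

(** * Peirce decomposition of an idempotent *)
(** The eigenvalues of [L_c] are roots of t (2t - 1) (t - 1), that is 0, 1/2 and 1. *)
Lemma peirce_cubic c : c ∘ c = c -> forall x,
  2 *: (c ∘ (c ∘ (c ∘ x))) - 3 *: (c ∘ (c ∘ x)) + c ∘ x = 0.
Proof.
move=> cc x; have := jmul_linearized x c c c.
rewrite cc !(jmulC J x c) cc !(jmulC J _ c) => H; vlin.
Qed.

Lemma peirce_commute c x : c ∘ c = c -> c ∘ x = x \/ c ∘ x = 0 ->
  forall y, c ∘ (x ∘ y) = x ∘ (c ∘ y).
Proof.
move=> cc cx y; have := jmul_linearized c c x y.
rewrite (jmulC J x c) cc; case: cx => ->; rewrite ?(jmul0x, jmulx0) => H; vlin.
Qed.

Lemma peirce_10 c x y : c ∘ c = c -> c ∘ x = x -> c ∘ y = 0 -> x ∘ y = 0.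
Proof.
move=> cc cx cy; have := peirce_commute cc (or_introl cx) y.
have := peirce_commute cc (or_intror cy) x.
by rewrite cx cy jmulx0 (jmulC J y x) => ->.
Qed.

Lemma peirce_11 c x y : c ∘ c = c -> c ∘ x = x -> c ∘ y = y ->
  c ∘ (x ∘ y) = x ∘ y.
Proof. by move=> cc cx cy; rewrite (peirce_commute cc (or_introl cx)) cy. Qed.

Lemma peirce_00 c x y : c ∘ c = c -> c ∘ x = 0 -> c ∘ y = 0 ->
  c ∘ (x ∘ y) = 0.
Proof.
by move=> cc cx cy; rewrite (peirce_commute cc (or_intror cx)) cy jmulx0.
Qed.

Lemma peirce_hh c x y : c ∘ x = 2^-1 *: x -> c ∘ y = 2^-1 *: y ->
  c ∘ c = c -> c ∘ (c ∘ (x ∘ y)) = c ∘ (x ∘ y).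
Proof.
move=> cx cy cc; have := jmul_linearized x y c c.
rewrite !(jmulC J _ c) cx cy cc !jmulE !(jmulC J _ c) cx cy !jmulE.
rewrite (jmulC J y x) => H; vlin.
Qed.

(** The second hypothesis places [x] in V_1(c) + V_0(c). The parts [c ∘ x] and [x - c ∘ x] satisfy
    [peirce_commute] separately. *)
Lemma peirce_idem_commute c x : c ∘ c = c -> c ∘ (c ∘ x) = c ∘ x ->
  forall y, c ∘ (x ∘ y) = x ∘ (c ∘ y).
Proof.
move=> cc ccx y.
have x1 := peirce_commute cc (or_introl ccx) y.
have c0 : c ∘ (x - c ∘ x) = 0 by rewrite jmulBr ccx subrr.
have := peirce_commute cc (or_intror c0) y.
by rewrite !jmulBl jmulBr x1 => /addIr.
Qed.

(** The quadratic representation 2 L_w^2 - L_(w^2) of w = 2c - e, when [c] is idempotent and hence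
    w^2 = e. *)
Definition reflection c x := 8 *: (c ∘ (c ∘ x)) - 8 *: (c ∘ x) + x.

Fact reflection_linear c : linear (reflection c).
Proof. by move=> k x y; rewrite /reflection !jmulE; vlin. Qed.
HB.instance Definition _ c := GRing.isLinear.Build R V V *:%R (reflection c)
  (reflection_linear c).

Lemma reflectionK c : c ∘ c = c -> involutive (reflection c).
Proof.
move=> cc x; rewrite /reflection !jmulE.
have H1 := peirce_cubic cc (c ∘ x); have H2 := peirce_cubic cc x.
clear cc; vlin.
Qed.

(* [reflection c] is [1] on the even part [V_1 + V_0] and [-1] on the odd part [V_(1/2)],
   and the product respects this grading. *)
Lemma reflectionM c x y : c ∘ c = c ->
  reflection c (x ∘ y) = reflection c x ∘ reflection c y.
Proof.
(* [odd] projects onto V_(1/2)(c): the polynomial 4t (1 - t) is 1 at t = 1/2 and 0 at t = 0, 1. *)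
move=> cc; pose odd u := 4 *: (c ∘ u) - 4 *: (c ∘ (c ∘ u)).
have oddE u : c ∘ odd u = 2^-1 *: odd u.
  rewrite /odd !jmulE; have := peirce_cubic cc u; clear; move=> H; vlin.
have evenE u : c ∘ (c ∘ (u - odd u)) = c ∘ (u - odd u).
  rewrite /odd !jmulE; have := peirce_cubic cc u => H1.
  have := peirce_cubic cc (c ∘ u) => H2; clear -H1 H2; vlin.
have reflO u : c ∘ u = 2^-1 *: u -> reflection c u = - u.
  by rewrite /reflection => H; rewrite !(H, jmulE); clear -J; vlin.
have reflE u : c ∘ (c ∘ u) = c ∘ u -> reflection c u = u.
  by rewrite /reflection => ->; rewrite addrC subrr addr0.
suff M x0 x1 y0 y1 : c ∘ (c ∘ x0) = c ∘ x0 -> c ∘ x1 = 2^-1 *: x1 ->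
    c ∘ (c ∘ y0) = c ∘ y0 -> c ∘ y1 = 2^-1 *: y1 ->
    reflection c ((x0 + x1) ∘ (y0 + y1)) =
    reflection c (x0 + x1) ∘ reflection c (y0 + y1).
  by have := M _ _ _ _ (evenE x) (oddE x) (evenE y) (oddE y); rewrite !subrK.
move=> x0E x1O y0E y1O.
have EE : c ∘ (c ∘ (x0 ∘ y0)) = c ∘ (x0 ∘ y0).
  by rewrite !(peirce_idem_commute cc x0E) y0E.
have EO : c ∘ (x0 ∘ y1) = 2^-1 *: (x0 ∘ y1).
  by rewrite (peirce_idem_commute cc x0E) y1O jmulZr.
have OE : c ∘ (x1 ∘ y0) = 2^-1 *: (x1 ∘ y0).
  by rewrite jmulC (jmulC J x1) (jmulC J _ c) (peirce_idem_commute cc y0E) x1O jmulZr.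
rewrite !(linearD (reflection c)) /= (reflE _ x0E) (reflE _ y0E).
rewrite (reflO _ x1O) (reflO _ y1O).
rewrite (jmulDl x0 x1) !(jmulDr _ y0 y1) !linearD /= (reflE _ EE) (reflO _ EO) (reflO _ OE).
rewrite (reflE _ (peirce_hh x1O y1O cc)) !jmulE; clear -J; vlin.
Qed.

Lemma reflection_automorphism c : c ∘ c = c ->
  jordan_automorphism J (reflection c).
Proof.
move=> cc; split=> [|x y]; last exact: reflectionM.
by exists (reflection c); apply: reflectionK.
Qed.

Lemma ip_jmul_idem_ge0 c x : c ∘ c = c -> 0 <= ⟨c ∘ x, x⟩.
Proof.
move=> cc; pose y := c ∘ (c ∘ x).
(* [L = L^2 + (2 L (1 - L))^2] for [L = L_c], whose spectrum is in {0, 1/2, 1}. *)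
have -> : ⟨c ∘ x, x⟩ = ⟨c ∘ x, c ∘ x⟩ + 4 * ⟨c ∘ x - y, c ∘ x - y⟩.
  have sa u v : ⟨u, c ∘ v⟩ = ⟨c ∘ u, v⟩ by rewrite -jmul_self_adjoint (jmulC J u).
  rewrite /y; have H1 := peirce_cubic cc x; have H2 := peirce_cubic cc (c ∘ x).
  apply (f_equal (jinner J ^~ x)) in H1, H2.
  rewrite !(ipDr, ipNr) !sa !jmulE !ipE in H1 H2 *; clear -H1 H2; lra.
by rewrite addr_ge0 ?mulr_ge0 ?ip_ge0.
Qed.

(** Degenerate Cauchy-Schwarz: a null vector of the positive semidefinite form phi(x ∘ y) lies in
    its radical. *)
Lemma psd_form_orth (phi : V -> R) c y : scalar phi ->
  (forall z, 0 <= phi (z ∘ z)) -> phi (c ∘ c) = 0 -> phi (c ∘ y) = 0.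
Proof.
move=> phiL phi0 phic; apply/eqP/negPn/negP => cy0.
(* Chosen so that phi takes the value -1 at the square of [t *: c + y]. *)
pose t := - (phi (y ∘ y) + 1) / (2 * phi (c ∘ y)).
have phiS k u v : phi (k *: u + v) = k * phi u + phi v by exact: phiL.
have phi_0 : phi 0 = 0 by have := phiS (-1) 0 0; rewrite scaler0 addr0 mulN1r addNr.
have phiD u v : phi (u + v) = phi u + phi v by have := phiS 1 u v; rewrite scale1r mul1r.
have phiZ k u : phi (k *: u) = k * phi u by have := phiS k u 0; rewrite phi_0 !addr0.
have := phi0 (t *: c + y); rewrite !jmulE (jmulC J y c) !(phiD, phiZ) phic.
have -> : t * phi (c ∘ y) = - (phi (y ∘ y) + 1) / 2.
  by rewrite /t; field.
lra.
Qed.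

(** The functional ⟨g, ·⟩ is nonnegative on squares and vanishes at [c = c ∘ c], so it vanishes at
    [c ∘ (g ∘ c)], where its value is the squared norm of [c ∘ g]. *)
Lemma idem_orth c g : c ∘ c = c -> g ∘ g = g -> ⟨c, g⟩ = 0 -> c ∘ g = 0.
Proof.
move=> cc gg cg; apply/eqP; rewrite -ip_eq0 jmulC.
rewrite jmul_self_adjoint (@psd_form_orth (jinner J g) c) //.
- by move=> k u v; rewrite /= ipDr ipZr.
- by move=> z; rewrite -jmul_self_adjoint ip_jmul_idem_ge0.
- by rewrite cc jinnerC.
Qed.

Lemma ip_idem_ge0 c y : c ∘ c = c -> 0 <= ⟨y ∘ y, c⟩.
Proof.
by move=> cc; rewrite jmul_self_adjoint jinnerC jmulC ip_jmul_idem_ge0.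
Qed.

(** * Power associativity and the spectral theorem *)
Section Powers.
Context (c x : V) (cc : c ∘ c = c) (cx : c ∘ x = x).

(* The powers of [x] in the subalgebra [V_1(c)], whose unit is [c]. *)
Definition jpow (m : nat) := iter m (jmul J x) c.

Lemma jpowS m : jpow m.+1 = x ∘ jpow m.
Proof. by []. Qed.

Lemma jpow_in m : c ∘ jpow m = jpow m.
Proof. by elim: m => //= m IH; rewrite peirce_11. Qed.

(** Two-step induction: the linearized identity expresses multiplication by x^(m+2) through [L_x],
    [L_(x ∘ x)] and multiplication by x^m and x^(m+1), all of which commute with [L_x]. *)
Lemma jpow_comm m y : jpow m ∘ (x ∘ y) = x ∘ (jpow m ∘ y).
Proof.
suff: (forall y, jpow m ∘ (x ∘ y) = x ∘ (jpow m ∘ y)) /\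
  (forall y, jpow m.+1 ∘ (x ∘ y) = x ∘ (jpow m.+1 ∘ y)) by case.
elim: m {y} => [|m [IH0 IH1]]; split=> // y.
- by rewrite /= peirce_commute //; left.
- by rewrite jpowS /= (jmulC J x c) cx.
have rec u : jpow m.+2 ∘ u = jpow m.+1 ∘ (x ∘ u) + (x ∘ x) ∘ (jpow m ∘ u) +
    jpow m.+1 ∘ (x ∘ u) - x ∘ (x ∘ (jpow m ∘ u)) - jpow m ∘ (x ∘ (x ∘ u)).
  have := jmul_linearized u x (jpow m) x.
  rewrite -jpowS (jmulC J (jpow m.+1) x) -jpowS (jmulC J u (jpow m.+2)).
  rewrite (jmulC J (jpow m ∘ u) x) (jmulC J (u ∘ x) x) (jmulC J u x).
  rewrite (jmulC J (jpow m ∘ u) (x ∘ x)) (jmulC J (jpow m) x) -jpowS.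
  rewrite (jmulC J (x ∘ u) (jpow m.+1)).
  by move=> H; clear -H; vlin.
rewrite !rec !jmulE !IH1 !IH0; congr (_ + _ + _ - _ - _).
by rewrite jmul_jordan.
Qed.

Lemma jpowM m l : jpow m ∘ jpow l = jpow (m + l).
Proof.
elim: l => [|l IH]; first by rewrite addn0 /= jmulC jpow_in.
by rewrite jpowS jpow_comm IH addnS.
Qed.
End Powers.

Section Evaluation.
Context (c x : V) (cc : c ∘ c = c) (cx : c ∘ x = x).
Implicit Types q : {poly R}.

Definition jeval q := \sum_(i < size q) q`_i *: jpow c x i.

Lemma jeval_widen q N : (size q <= N)%N ->
  jeval q = \sum_(i < N) q`_i *: jpow c x i.
Proof.
move=> qN; rewrite /jeval (big_ord_widen N (fun i => q`_i *: jpow c x i) qN).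
rewrite big_mkcond; apply: eq_bigr => i _; case: ltnP => // qi.
by rewrite nth_default // scale0r.
Qed.

Fact jeval_linear : linear jeval.
Proof.
move=> k p q; pose N := maxn (maxn (size p) (size q)) (size (k *: p + q)).
rewrite !(@jeval_widen _ N) ?leq_max ?leqnn ?orbT //.
rewrite scaler_sumr -big_split; apply: eq_bigr => i _ /=.
by rewrite coefD coefZ scalerDl scalerA.
Qed.
HB.instance Definition _ := GRing.isLinear.Build R {poly R} V *:%R jeval
  jeval_linear.

Lemma jevalMX q : jeval (q * 'X) = x ∘ jeval q.
Proof.
have [->|q0] := eqVneq q 0; first by rewrite mul0r !linear0.
rewrite /jeval size_mulX // big_ord_recl coefMX /= scale0r add0r linear_sum /=.
by apply: eq_bigr => i _; rewrite coefMX /= jmulZr.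
Qed.

Lemma jevalC k : jeval k%:P = k *: c.
Proof.
rewrite (@jeval_widen _ 1) ?size_polyC ?leq_b1 //.
by rewrite big_ord1 coefC.
Qed.

Lemma jeval_in q : c ∘ jeval q = jeval q.
Proof.
rewrite linear_sum; apply: eq_bigr => i _.
by rewrite /= jmulZr jpow_in.
Qed.

Lemma jeval_eigen r q (s : {poly R}) : x ∘ jeval s = r *: jeval s ->
  jeval q ∘ jeval s = q.[r] *: jeval s.
Proof.
move=> xs; rewrite horner_coef scaler_suml jmul_suml; apply: eq_bigr => i _.
rewrite jmulZl -scalerA; congr (_ *: _).
(* By power associativity, multiplying a polynomial in [x] by x^i amounts to multiplying it [i]
   times by [x]. *)
transitivity (iter i (jmul J x) (jeval s)).
  elim: (i : nat) => [|k IH] /=; first by rewrite jeval_in.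
  rewrite -IH /jeval !linear_sum /=.
  apply: eq_bigr => j _; rewrite !linearZ /=; congr (_ *: _).
  by rewrite -jpowS !jpowM.
by elim: (i : nat) => [|k IH] /=; rewrite ?expr0 ?scale1r // IH jmulZr xs scalerA -exprSr.
Qed.

(** One more power of [x] than the dimension of [V] gives a linear relation, read as a
    polynomial. *)
Lemma jeval_annihilated : exists2 q, q != 0 & jeval q = 0.
Proof.
pose N := (\dim (fullv : {vspace V})).+1.
pose X := [tuple jpow c x i | i < N].
have : ~~ free X.
  apply/negP => /eqP fX; have := dimvS (subvf <<X>>%VS).
  by rewrite fX size_tuple ltnn.
move=> /freeP/existsNP[k /not_implyP[kX /existsNP[i0 ki0]]].
pose q := \poly_(i < N) k (inord i).
have qE (i : 'I_N) : q`_i = k i by rewrite coef_poly ltn_ord inord_val.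
exists q.
  by apply: contra_notN ki0 => /eqP q0; rewrite -qE q0 coef0.
rewrite (@jeval_widen q N) ?size_poly // -[RHS]kX; apply: eq_bigr => i _.
by rewrite qE -tnth_nth tnth_mktuple.
Qed.

(* The factors of a polynomial annihilating [x] are discarded one by one; an irreducible
   quadratic one never survives, because [(L_x - a)^2 + b^2] is positive definite. *)
Lemma jeval_eigenvector : c != 0 ->
  exists (s : {poly R}) r, jeval s != 0 /\ x ∘ jeval s = r *: jeval s.
Proof.
move=> c0; have [q] := jeval_annihilated.
have [n] := ubnP (size q); elim: n q => // n IH q qn q0 xq.
have [q1|q1] := leqP (size q) 1.
  move: q0 xq; rewrite (size1_polyC q1) polyC_eq0 jevalC => q0 /eqP.
  by rewrite scaler_eq0 (negPf q0) (negPf c0).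
have lt_size (u v : {poly R}) : q = u * v -> (1 < size v)%N -> (size u < n)%N.
  move=> quv v1; have := q0; rewrite quv mulf_eq0 negb_or => /andP[u0 v0].
  move: qn; rewrite ltnS quv size_mul // => /(leq_trans _); apply.
  by case: (size v) v1 => [|[|l]] // _; rewrite addnS /= addnS ltnS leq_addr.
have fac_neq0 (u v : {poly R}) : q = u * v -> u != 0.
  by move=> quv; apply: contraNneq q0 => u0; rewrite quv u0 mul0r.
case: (real_poly_factor q1) => [[r [s qs]]|[a [b [s [b0 qs]]]]].
  have [s0|s0] := eqVneq (jeval s) 0.
    by apply: (IH s) => //; [rewrite (lt_size _ _ qs) ?size_XsubC|exact: fac_neq0 qs].
  exists s, r; split=> //; apply/eqP; rewrite -subr_eq0; apply/eqP.
  rewrite -xq qs mulrBr linearB /= jevalMX; congr (_ - _).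
  by rewrite mulrC mul_polyC linearZ.
apply: (IH s); [apply: (lt_size _ _ qs)|exact: fac_neq0 qs|].
  rewrite size_polyDl size_exp_XsubC //.
  by rewrite size_polyC; case: (_ == _).
apply/eqP; rewrite -ip_eq0; apply/eqP.
have : jeval q = x ∘ (x ∘ jeval s) - (a + a) *: (x ∘ jeval s) + (a ^+ 2 + b ^+ 2) *: jeval s.
  rewrite qs -!jevalMX -!linearZ -linearB -linearD; congr (jeval _).
  rewrite -!mul_polyC !expr2 !(polyCM, polyCD).
  ring.
rewrite xq => /(congr1 (jinner J ^~ (jeval s))); set y := jeval s.
rewrite !ipE (jmulC J x (x ∘ y)) jmul_self_adjoint => H.
have := ip_ge0 (x ∘ y - a *: y).
rewrite !(ipE, ipEr) (jinnerC J y (x ∘ y)) => H'.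
have b2 : 0 < b ^+ 2 by rewrite exprn_even_gt0.
have y0 := ip_ge0 y; apply/eqP; rewrite eq_le y0 andbT.
rewrite -(pmulr_rle0 _ b2); nra.
Qed.

End Evaluation.

Lemma idem_compl c g : c ∘ c = c -> g ∘ g = g -> c ∘ g = g ->
  (c - g) ∘ (c - g) = c - g.
Proof.
by move=> cc gg cg; rewrite !jmulE cc gg (jmulC J g c) cg; clear -J; vlin.
Qed.

Lemma idem_sum_orth a b : a ∘ a = a -> b ∘ b = b ->
  (a + b) ∘ (a + b) = a + b -> a ∘ b = 0.
Proof.
by rewrite !jmulE => -> ->; rewrite (jmulC J b a) => H; vlin.
Qed.

(* An eigenvector [y] of [L_x] in [R[x]] satisfies [y^2 = k y], so [y / k] is idempotent. *)
Lemma idem_split c x : c ∘ c = c -> c ∘ x = x -> (forall k, x != k *: c) ->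
  exists g r, [/\ g != 0, g != c, g ∘ g = g, c ∘ g = g & x ∘ g = r *: g].
Proof.
move=> cc cx xc.
have c0 : c != 0.
  by apply: contraNneq (xc 0) => c0; rewrite scale0r -cx c0 jmul0x.
have [s [r [y0 xy]]] := jeval_eigenvector x c0.
have yy := jeval_eigen cc cx s xy.
have cy := jeval_in cc cx s; set y := jeval c x s in y0 xy yy cy *.
(* Since y ∘ y = s(r) y and c ∘ y = y, the squared norm of [y] is s(r) ⟨y, c⟩. *)
have q0 : s.[r] != 0.
  apply: contraNneq y0 => q0; rewrite -ip_eq0 -{2}cy.
  by rewrite (jmulC J c) -jmul_self_adjoint yy q0 scale0r ip0x.
exists (s.[r]^-1 *: y), r; split.
- by rewrite scaler_eq0 invr_eq0 negb_or q0.
- apply: contraNneq (xc r) => yc; rewrite -cx jmulC -yc.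
  by rewrite jmulZr xy !scalerA mulrC.
- by rewrite jmulZl jmulZr yy !scalerA -mulrA mulVf // mulr1.
- by rewrite jmulZr cy.
- by rewrite jmulZr xy !scalerA mulrC.
Qed.

Lemma primitive_line c x : primitive_idempotent J c -> c ∘ x = x ->
  exists k, x = k *: c.
Proof.
move=> [[c0 cc] cP] cx; apply: contra_notP cP => /forallNP xc.
have [|g [r [g0 gc gg cg _]]] := idem_split cc cx; first by move=> k; apply/eqP.
exists g, (c - g); split; last by rewrite addrC subrK.
- by split.
- by split; [rewrite subr_eq0 eq_sym|exact: idem_compl].
Qed.

(** 2 L_c^2 - L_c is the projection onto V_1(c), which is the line through [c]. Pairing with [c]
    gives the coefficient. *)
Lemma primitive_quadratic c x : primitive_idempotent J c ->
  2 *: (c ∘ (c ∘ x)) - c ∘ x = (⟨x, c⟩ / ⟨c, c⟩) *: c.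
Proof.
move=> cP; have [[c0 cc] _] := cP; set y := _ - _.
have cy : c ∘ y = y.
  by rewrite /y !jmulE; have H := peirce_cubic cc x; clear -H; vlin.
have [k yk] := primitive_line cP cy.
have : ⟨y, c⟩ = ⟨x, c⟩.
  rewrite /y !ipE (jmulC J c (c ∘ x)) (jmulC J c x) !jmul_self_adjoint !cc; lra.
rewrite yk ipZl => <-; congr (_ *: _); rewrite mulfK // ip_eq0 //.
Qed.

Definition peirce1 c := lker (linfun (jmul J c \- idfun)).
Definition peirce0 c := lker (linfun (jmul J c)).

Lemma mem_peirce1 c x : (x \in peirce1 c) = (c ∘ x == x).
Proof. by rewrite memv_ker lfunE /= subr_eq0. Qed.

Lemma mem_peirce0 c x : (x \in peirce0 c) = (c ∘ x == 0).
Proof. by rewrite memv_ker lfunE. Qed.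

Lemma peirce1_sum a b x : a ∘ a = a -> b ∘ b = b -> a ∘ b = 0 -> a ∘ x = x ->
  (a + b) ∘ x = x.
Proof.
move=> aa bb ab ax; rewrite jmulDl ax (jmulC J b) (peirce_10 aa ax ab).
by rewrite addr0.
Qed.

Lemma dim_peirce1_lt a b : a ∘ a = a -> b ∘ b = b -> a ∘ b = 0 -> b != 0 ->
  (\dim (peirce1 a) < \dim (peirce1 (a + b)))%N.
Proof.
move=> aa bb ab b0.
have sub : (peirce1 a <= peirce1 (a + b))%VS.
  apply/subvP => x; rewrite !mem_peirce1 => /eqP ax.
  by rewrite peirce1_sum.
rewrite (ltn_leqif (dimv_leqif_sup sub)); apply/negP => /subvP/(_ (a + b)).
rewrite !mem_peirce1 !jmulE aa bb ab (jmulC J b) ab addr0 add0r eqxx => /(_ isT).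
by rewrite eq_sym -subr_eq0 addrC addKr (negPf b0).
Qed.

(** Induction on dim V_1(c): unless [c] is zero or primitive, it splits into two orthogonal
    idempotents along which [x] splits as well. *)
Lemma spectral_seq c x : c ∘ c = c -> c ∘ x = x ->
  exists s : seq (R * V),
    [/\ {in s, forall p, primitive_idempotent J p.2 /\ c ∘ p.2 = p.2},
        pairwise (fun p q => p.2 ∘ q.2 == 0) s,
        \sum_(p <- s) p.2 = c & \sum_(p <- s) p.1 *: p.2 = x].
Proof.
have [n] := ubnP (\dim (peirce1 c)); elim: n c x => // n IH c x dn cc cx.
have [c0|c0] := eqVneq c 0.
  exists [::]; split=> //; rewrite big_nil // -cx.
  by rewrite c0 jmul0x.
have [cP|cNP] := pselect (primitive_idempotent J c).
  have [k ->] := primitive_line cP cx.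
  exists [:: (k, c)]; split; rewrite ?big_seq1 // => p.
  by rewrite inE => /eqP ->.
have [c1 [c2 [x1 [x2 [[c10 c11] [c20 c22] cE [xE c1x c2x]]]]]] :
    exists c1 c2 x1 x2, [/\ idempotent_elt J c1, idempotent_elt J c2,
    c = c1 + c2 & [/\ x = x1 + x2, c1 ∘ x1 = x1 & c2 ∘ x2 = x2]].
  (* For a multiple of [c] any splitting of [c] will do. Otherwise [idem_split] supplies an
     idempotent that is an eigenvector of [L_x]. *)
  have [[k xk]|/forallNP xk] := pselect (exists k, x = k *: c).
    have [a [b [[a0 aa] [b0 bb] ab]]] : exists a b,
        [/\ idempotent_elt J a, idempotent_elt J b & c = a + b].
      by apply: contra_notP cNP => cNP; split.
    exists a, b, (k *: a), (k *: b); split=> //.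
    by rewrite xk ab scalerDr !jmulZr aa bb.
  have [|g [r [g0 gc gg cg xg]]] := idem_split cc cx; first by move=> k; apply/eqP.
  exists g, (c - g), (r *: g), (x - r *: g); split.
  - by split.
  - by split; [rewrite subr_eq0 eq_sym|exact: idem_compl].
  - by rewrite addrC subrK.
  - split; first by rewrite addrC subrK.
      by rewrite jmulZr gg.
    by rewrite !jmulE cx cg gg (jmulC J g) xg; clear -J; vlin.
have c12 : c1 ∘ c2 = 0 by apply: idem_sum_orth => //; rewrite -cE.
have c21 : c2 ∘ c1 = 0 by rewrite jmulC.
have [|s1 [s1P s1O s1c s1x]] := IH c1 x1 _ c11 c1x.
  by rewrite (leq_trans (dim_peirce1_lt c11 c22 c12 c20)) // -cE.
have [|s2 [s2P s2O s2c s2x]] := IH c2 x2 _ c22 c2x.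
  by rewrite (leq_trans (dim_peirce1_lt c22 c11 c21 c10)) // addrC -cE.
exists (s1 ++ s2); split.
- move=> p; rewrite mem_cat => /orP[/s1P|/s2P] [pP cp]; split=> //; rewrite cE.
    exact: peirce1_sum.
  by rewrite addrC peirce1_sum.
- rewrite pairwise_cat s1O s2O !andbT; apply/allrelP => p q /s1P[_ p1] /s2P[_ q2].
  apply/eqP/(peirce_10 c11 p1).
  by rewrite jmulC; apply: (peirce_10 c22).
- by rewrite big_cat /= s1c s2c.
- by rewrite big_cat /= s1x s2x.
Qed.

(** * Reflections exchanging primitive idempotents *)

Lemma idem_norm_gt0 c : idempotent_elt J c -> 0 < ⟨c, c⟩.
Proof. by case=> c0 _; apply: jinner_gt0. Qed.

Lemma ip_idem_le c g : g ∘ g = g -> c ∘ g = g -> ⟨c, g⟩ = ⟨g, g⟩.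
Proof. by move=> gg cg; rewrite -{1}gg -jmul_self_adjoint cg. Qed.

(** By [primitive_quadratic], twice the squared norm of [a ∘ b] is ⟨a,b⟩ + ⟨a,b⟩^2 / ⟨a,a⟩, and also
    the same expression with [a] and [b] exchanged. *)
Lemma primitive_norm_eq a b : primitive_idempotent J a ->
  primitive_idempotent J b -> ⟨a, b⟩ != 0 -> ⟨a, a⟩ = ⟨b, b⟩.
Proof.
move=> aP bP ab0.
have key u v : primitive_idempotent J u -> primitive_idempotent J v ->
    2 * ⟨u ∘ v, u ∘ v⟩ = ⟨u, v⟩ + ⟨u, v⟩ / ⟨u, u⟩ * ⟨u, v⟩.
  move=> uP [[_ vv] _].
  have := congr1 (jinner J ^~ v) (primitive_quadratic v uP).
  rewrite !ipE (jmulC J u (u ∘ v)) !jmul_self_adjoint vv (jinnerC J v u).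
  lra.
have := key _ _ bP aP; rewrite (jmulC J b a) key // (jinnerC J b a) => /addrI.
move=> /(mulIf ab0)/(mulfI ab0)/invr_inj //.
Qed.

Section NonOrthogonal.
Context (a b : V) (aP : primitive_idempotent J a).
Context (bP : primitive_idempotent J b) (ab0 : ⟨a, b⟩ != 0).

(* For rank-one projections [a = u u^T], [b = v v^T] with [u.v = s > 0], [c] is the
   projection on the line of [u + v]. *)
Lemma exchange_nonorth :
  exists c k l, [/\ c ∘ c = c, reflection c a = b, ⟨c, c⟩ = ⟨a, a⟩, k != 0 &
    c = k *: (a + b) + l *: (a ∘ b)].
Proof.
have [[a0 aa] _] := aP; have [[b0 bb] _] := bP.
have abN := primitive_norm_eq aP bP ab0.
have N0 : 0 < ⟨a, a⟩ by apply: idem_norm_gt0.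
set N := ⟨a, a⟩ in abN N0 *; pose mu := ⟨a, b⟩ / N.
have mu0 : 0 < mu.
  rewrite divr_gt0 // lt_def ab0 /=.
  by have := ip_idem_ge0 a bb; rewrite aa.
pose s := Num.sqrt mu; have s0 : 0 < s by rewrite sqrtr_gt0.
have s2 : mu = s * s by rewrite -expr2 sqr_sqrtr // ltW.
have [d dE] : exists d, d = a ∘ b by exists (a ∘ b).
have ab : a ∘ b = d by []. have ba : b ∘ a = d by rewrite jmulC.
have ad : a ∘ d = 2^-1 *: d + (mu / 2) *: a.
  have := primitive_quadratic b aP; rewrite (jinnerC J b a) -/N -/mu ab => H.
  by clear -H; vlin.
have bd : b ∘ d = 2^-1 *: d + (mu / 2) *: b.
  have := primitive_quadratic a bP; rewrite -abN -/mu ba => H.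
  by clear -H; vlin.
have da : d ∘ a = 2^-1 *: d + (mu / 2) *: a by rewrite jmulC.
have db : d ∘ b = 2^-1 *: d + (mu / 2) *: b by rewrite jmulC.
have dd : d ∘ d = (mu / 4) *: a + (mu / 4) *: b + (mu / 2) *: d.
  have := jmul_linearized a a b b; rewrite ab ba aa bb ab db bd !jmulE ad ab => H.
  clear -H; apply: ip_ext => z; move: (congr1 (jinner J ^~ z) H).
  by rewrite !ipE; lra.
have dab : ⟨d, b⟩ = s * s * N.
  rewrite dE jmul_self_adjoint bb -s2 /mu; field; clear -s0 N0; lra.
have daa : ⟨d, a⟩ = s * s * N.
  rewrite dE jmulC jmul_self_adjoint aa -s2 /mu jinnerC; field; clear -s0 N0; lra.
have ddd : 2 * ⟨d, d⟩ = s * s * N + s * s * s * s * N.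
  have := congr1 (jinner J b) ad; rewrite -jmul_self_adjoint ba !ipEr.
  rewrite (jinnerC J b d) dab (jinnerC J b a).
  have -> : ⟨a, b⟩ = s * s * N by rewrite -s2 /mu; field; clear -s0 N0; lra.
  by rewrite s2; clear; lra.
(* In the rank-one model, [k] is the inverse squared length of u + v, and u v^T + v u^T equals (2 /
   s) [a ∘ b]. *)
pose k := (2 + 2 * s)^-1; pose l := k * 2 / s.
exists (k *: (a + b) + l *: d), k, l; split.
- rewrite !jmulE aa bb ab ba da db ad bd dd; apply: ip_ext => z; rewrite !ipE.
  rewrite /l /k s2; field; clear -s0 N0; lra.
- rewrite /reflection !jmulE aa ba da !jmulE aa ba ad bd da dd.
  apply: ip_ext => z; rewrite !ipE /l /k s2; field; clear -s0 N0; lra.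
- rewrite !(ipE, ipEr) !(jinnerC J _ d) dab daa -abN -/N (jinnerC J b a).
  have -> : ⟨a, b⟩ = s * s * N by rewrite -s2 /mu; field; clear -s0 N0; lra.
  have -> : ⟨d, d⟩ = (s * s * N + s * s * s * s * N) / 2 by clear -ddd; lra.
  rewrite /l /k; field; clear -s0 N0; lra.
- by rewrite invr_eq0; clear -s0; lra.
- by rewrite dE.
Qed.
End NonOrthogonal.

Lemma idem_primitive_below c : idempotent_elt J c ->
  exists g, [/\ primitive_idempotent J g, c ∘ g = g & ⟨g, g⟩ <= ⟨c, c⟩].
Proof.
move=> [c0 cc]; have [[|p s] [sP _ sc _]] := spectral_seq cc cc.
  by move: c0; rewrite -sc big_nil eqxx.
have [pP cp] := sP p (mem_head _ _); exists p.2; split=> //.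
rewrite -{2}sc ip_sumr big_cons (ip_idem_le _ cp) ?lerDl; last by case: pP => -[].
rewrite big_seq sumr_ge0 // => q qs.
have [[[_ qq] _] cq] : primitive_idempotent J q.2 /\ c ∘ q.2 = q.2.
  by apply: sP; rewrite inE qs orbT.
by rewrite (ip_idem_le qq cq) ip_ge0.
Qed.

(** A primitive idempotent below [c] is not orthogonal to both [a] and [b], so it has their norm. A
    splitting of [c] would then give it at least twice the squared norm of [a]. *)
Lemma exchange_nonorth_primitive a b c k l : primitive_idempotent J a ->
  primitive_idempotent J b -> ⟨a, b⟩ != 0 -> c ∘ c = c -> ⟨c, c⟩ = ⟨a, a⟩ ->
  c = k *: (a + b) + l *: (a ∘ b) -> primitive_idempotent J c.
Proof.
move=> aP bP ab0 cc cN cE.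
have [[a0 aa] _] := aP; have [[_ bb] _] := bP.
have abN := primitive_norm_eq aP bP ab0.
have aN0 : 0 < ⟨a, a⟩ by exact: jinner_gt0.
split; first by split=> //; rewrite -ip_eq0 cN gt_eqF.
case=> c1 [c2 [[c10 c11] [c20 c22] c12]].
have c12o : c1 ∘ c2 = 0 by apply: idem_sum_orth; rewrite // -c12.
have c21o : c2 ∘ c1 = 0 by rewrite jmulC.
have norm_ge c' : idempotent_elt J c' -> (forall g, c' ∘ g = g -> c ∘ g = g) ->
    ⟨a, a⟩ <= ⟨c', c'⟩.
  move=> c'P c'c; have [g [gP /c'c cg]] := idem_primitive_below c'P.
  suff <- : ⟨g, g⟩ = ⟨a, a⟩ by [].
  have [[_ gg] _] := gP.
  have [ga|/eqP/primitive_norm_eq->//] := pselect (⟨g, a⟩ = 0); last first.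
  have [gb|/eqP/primitive_norm_eq->//] := pselect (⟨g, b⟩ = 0); last first.
  exfalso; have := idem_norm_gt0 gP.1; rewrite -(ip_idem_le gg cg) cE jinnerC.
  rewrite !ipEr ga gb -jmul_self_adjoint idem_orth // ip0x.
  by rewrite addr0 !mulr0 addr0 ltxx.
have n1 : ⟨a, a⟩ <= ⟨c1, c1⟩.
  by apply: norm_ge => // g; rewrite c12; apply: peirce1_sum.
have n2 : ⟨a, a⟩ <= ⟨c2, c2⟩.
  by apply: norm_ge => // g; rewrite c12 addrC; apply: peirce1_sum.
have c120 : ⟨c1, c2⟩ = 0 by rewrite -c22 -jmul_self_adjoint c12o ip0x.
move: cN; rewrite c12 !(ipE, ipEr) (jinnerC J c2) c120 => cN.
by clear -cN n1 n2 aN0; lra.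
Qed.

(** A path of length two in the graph of non-orthogonality; [d = a] is allowed. *)
Definition linked a b :=
  exists d, [/\ primitive_idempotent J d, ⟨a, d⟩ != 0 & ⟨d, b⟩ != 0].

(** Shortens the path a, d, b, b' by replacing [d] and [b] with the primitive idempotent [c] halfway
    between them. In the remaining case a ⊥ b and d ⊥ b', so ⟨a, c⟩ = k ⟨a, d⟩ and ⟨c, b'⟩ = k ⟨b,
    b'⟩. *)
Lemma linked_step a b b' : primitive_idempotent J a ->
  primitive_idempotent J b -> primitive_idempotent J b' ->
  linked a b -> ⟨b, b'⟩ != 0 -> linked a b'.
Proof.
move=> aP bP b'P [d [dP ad db]] bb'.
have [ab|ab] := eqVneq ⟨a, b⟩ 0; last by exists b.
have [db'|db'] := eqVneq ⟨d, b'⟩ 0; last by exists d.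
have [c [k [l [cc _ cN k0 cE]]]] := exchange_nonorth dP bP db.
have cP := exchange_nonorth_primitive dP bP db cc cN cE.
have [[_ aa] _] := aP; have [[_ bb] _] := bP.
have [[_ dd] _] := dP; have [[_ b'b'] _] := b'P.
exists c; split=> //; rewrite cE !(ipE, ipEr).
  rewrite ab (jmulC J d) -jmul_self_adjoint (idem_orth aa bb ab) ip0x.
  by rewrite mulr0 !addr0 mulf_neq0.
rewrite db' (jmulC J d) jmul_self_adjoint (idem_orth dd b'b' db') ipx0.
by rewrite mulr0 add0r addr0 mulf_neq0.
Qed.

Lemma spectral_sum x : exists s : seq (R * V),
  {in s, forall p, primitive_idempotent J p.2} /\
  \sum_(p <- s) p.1 *: p.2 = x.
Proof.
have [s [sP _ _ sx]] := spectral_seq (jmul1x 'e) (jmul1x x).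
by exists s; split=> // p /sP[].
Qed.

Section Simple.
Hypothesis Jsimple : simple_EJA J.

(* If [c] is the sum of the members of a frame linked to [a], then [V_(1/2)(c) = 0] and
   [V = V_1(c) + V_0(c)] is a direct sum of algebras. *)
Lemma simple_linked a b : primitive_idempotent J a ->
  primitive_idempotent J b -> linked a b.
Proof.
move=> aP bP; have [s [sP _ se _]] := spectral_seq (jmul1x 'e) (jmul1x 'e).
pose c := \sum_(p <- s | `[< linked a p.2 >]) p.2.
have cL g : primitive_idempotent J g -> linked a g -> c ∘ g = g.
  move=> gP ag; rewrite -{2}[g]jmul1x -se !jmul_suml.
  rewrite [RHS](bigID (fun p : R * V => `[< linked a p.2 >])) /=.
  rewrite [X in _ + X]big_seq_cond [X in _ + X]big1 ?addr0 // => p /andP[/sP[pP _] /asboolPn ap].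
  apply: idem_orth; [by case: pP => -[]|by case: gP => -[]|].
  apply/eqP; apply: contra_notT ap => pg; apply: linked_step ag _ => //.
  by rewrite jinnerC.
have cNL g : primitive_idempotent J g -> ~ linked a g -> c ∘ g = 0.
  move=> gP ag; rewrite jmul_suml big_seq_cond big1 // => p.
  move=> /andP[/sP[pP _] /asboolP ap].
  apply: idem_orth; [by case: pP => -[]|by case: gP => -[]|].
  by apply/eqP; apply: contra_notT ag => pg; apply: linked_step ap pg.
have cc : c ∘ c = c.
  have -> : c ∘ c = \sum_(p <- s | `[< linked a p.2 >]) c ∘ p.2 by exact: linear_sum.
  rewrite /c big_seq_cond [RHS]big_seq_cond -/c.
  by apply: eq_bigr => p /andP[/sP[pP _] /asboolP ap]; rewrite cL.
(* Primitive idempotents span, and [L_c] is 1 or 0 on each of them; hence V_(1/2)(c) = 0. *)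
have ccx x : c ∘ (c ∘ x) = c ∘ x.
  have [t [tP <-]] := spectral_sum x; rewrite !linear_sum big_seq [RHS]big_seq.
  apply: eq_bigr => p /tP pP; rewrite !linearZ /=; congr (_ *: _).
  have [ap|ap] := pselect (linked a p.2); first by rewrite !(cL _ pP ap).
  by rewrite !(cNL _ pP ap) jmulx0.
have aa : linked a a.
  by exists a; have [[a0 _] _] := aP; rewrite ip_eq0.
apply: contrapT => abN; apply: Jsimple.2; exists (peirce1 c), (peirce0 c); split.
- have [[a0 _] _] := aP; apply: contraNneq a0 => U0.
  by rewrite -memv0 -U0 mem_peirce1 cL.
- have [[b0 _] _] := bP; apply: contraNneq b0 => W0.
  by rewrite -memv0 -W0 mem_peirce0 cNL.
split.
- split=> x y.
    by rewrite !mem_peirce1 => /eqP cx /eqP cy; rewrite peirce_11.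
  by rewrite !mem_peirce0 => /eqP cx /eqP cy; rewrite peirce_00.
- split; apply/eqP.
    rewrite eqEsubv subvf; apply/subvP => x _.
    rewrite -[x](subrK (c ∘ x)) addrC; apply: memv_add.
      by rewrite mem_peirce1 ccx.
    by rewrite mem_peirce0 linearB /= ccx subrr.
  rewrite -subv0; apply/subvP => x; rewrite memv_cap mem_peirce1 mem_peirce0.
  by move=> /andP[/eqP cx /eqP cx0]; rewrite -cx cx0 mem0v.
- by move=> x y; rewrite mem_peirce1 mem_peirce0 => /eqP cx /eqP; apply: peirce_10.
- move=> x y; rewrite mem_peirce1 mem_peirce0 => /eqP cx /eqP cy.
  by rewrite -cx (jmulC J c) jmul_self_adjoint cy ipx0.
Qed.

Lemma simple_primitive_norm a b : primitive_idempotent J a ->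
  primitive_idempotent J b -> ⟨a, a⟩ = ⟨b, b⟩.
Proof.
move=> aP bP; have [d [dP ad db]] := simple_linked aP bP.
by rewrite (primitive_norm_eq aP dP ad); apply: primitive_norm_eq.
Qed.

(* A common neighbour [d] of the orthogonal [a], [b] gives the nonzero off-diagonal
   component [a ∘ (b ∘ d)] in [V_(1/2)(a) ∩ V_(1/2)(b)]; [z] is a multiple of it. *)
Lemma exchange_orth a b : primitive_idempotent J a ->
  primitive_idempotent J b -> ⟨a, b⟩ = 0 ->
  exists c z, [/\ c ∘ c = c, reflection c a = b, (a + b) ∘ z = z &
    c = 2^-1 *: (a + b + z)].
Proof.
move=> aP bP abo; have [d [dP ad0 db0]] := simple_linked aP bP.
have [[a0 aa] _] := aP; have [[b0 bb] _] := bP; have [[d0 dd] _] := dP.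
have ab := idem_orth aa bb abo; have ba : b ∘ a = 0 by rewrite jmulC.
pose x := a ∘ (b ∘ d).
have xE : x = b ∘ (a ∘ d) by rewrite /x (peirce_commute aa) //; right.
have ax : a ∘ x = 2^-1 *: x.
  have := primitive_quadratic (b ∘ d) aP.
  rewrite (jmulC J b d) jmul_self_adjoint ba ipx0 mul0r scale0r.
  by rewrite (jmulC J d b) -/x => H; clear -H; vlin.
have bx : b ∘ x = 2^-1 *: x.
  have := primitive_quadratic (a ∘ d) bP.
  rewrite (jmulC J a d) jmul_self_adjoint ab ipx0 mul0r scale0r.
  by rewrite (jmulC J d a) -xE => H; clear -H; vlin.
(* Pairing [primitive_quadratic a dP] with [b] gives 2 ⟨x, d⟩ = ⟨a, d⟩ ⟨d, b⟩ / ⟨d, d⟩. *)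
have x0 : x != 0.
  apply: contraNneq (mulf_neq0 ad0 db0) => x0.
  have xd : ⟨d ∘ a, d ∘ b⟩ = ⟨x, d⟩.
    by rewrite /x (jmulC J a (b ∘ d)) [RHS]jmul_self_adjoint [RHS]jinnerC
               (jmulC J d a) (jmulC J d b).
  have := congr1 (jinner J ^~ b) (primitive_quadratic a dP).
  rewrite !ipE (jmulC J d (d ∘ a)) (jmul_self_adjoint J (d ∘ a)) xd x0 ip0x.
  rewrite jmul_self_adjoint ab ipx0 mulr0 subr0 mulrAC => /esym/eqP.
  by rewrite [_ / _ == 0]mulf_eq0 invr_eq0 ip_eq0 (negPf d0) orbF.
have nab := simple_primitive_norm aP bP.
have aN0 : 0 < ⟨a, a⟩ by exact: jinner_gt0.
have xN0 : 0 < ⟨x, x⟩ by exact: jinner_gt0.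
have abab : (a + b) ∘ (a + b) = a + b by rewrite !jmulE aa bb ab ba addr0 add0r.
have abx : (a + b) ∘ x = x by rewrite jmulDl ax bx; clear -J; vlin.
pose q := ⟨x, x⟩ / (2 * ⟨a, a⟩).
(* The equality of all primitive norms makes the coefficient [q] the same for [a] and [b]. *)
have diag u : primitive_idempotent J u -> u ∘ x = 2^-1 *: x -> u ∘ (x ∘ x) = q *: u.
  move=> uP ux; have [[_ uu] _] := uP.
  have := primitive_quadratic (x ∘ x) uP; rewrite (peirce_hh ux ux uu).
  rewrite jmul_self_adjoint (jmulC J x u) ux ipZr.
  rewrite (simple_primitive_norm uP aP) => H.
  have -> : q = 2^-1 * ⟨x, x⟩ / ⟨a, a⟩ by rewrite /q invfM mulrA [_ / 2]mulrC.
  by clear -H; vlin.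
have xx : x ∘ x = q *: (a + b).
  by rewrite -(peirce_11 abab abx abx) jmulDl !diag // scalerDr.
have q0 : 0 < q by rewrite divr_gt0 // mulr_gt0.
(* Rescales [x] so that [z] squares to [a + b], the unit of V_1(a + b). *)
pose t := (Num.sqrt q)^-1; pose z := t *: x.
have tq : t * t * q = 1.
  rewrite -expr2 /t exprVn sqr_sqrtr ?mulVf ?gt_eqF //; exact: ltW.
have az : a ∘ z = 2^-1 *: z by rewrite jmulZr ax !scalerA mulrC.
have bz : b ∘ z = 2^-1 *: z by rewrite jmulZr bx !scalerA mulrC.
have zz : z ∘ z = a + b.
  by rewrite jmulZl jmulZr xx !scalerA tq scale1r.
have za : z ∘ a = 2^-1 *: z by rewrite jmulC.
have zb : z ∘ b = 2^-1 *: z by rewrite jmulC.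
clearbody z; exists (2^-1 *: (a + b + z)), z; split=> //.
- by rewrite !jmulE aa bb ab ba az bz za zb zz; clear -J; vlin.
- rewrite /reflection !jmulE aa ba za !jmulE aa !jmulx0 az bz zz.
  by clear -J; vlin.
- by rewrite jmulDl az bz; clear -J; vlin.
Qed.

(** The last clause lets frames be matched one member at a time: [c] is built inside V_1(a + b) or
    from [a], [b], [a ∘ b], so what is orthogonal to [a] and [b] is left alone. *)
Lemma exchange a b : primitive_idempotent J a -> primitive_idempotent J b ->
  exists c, [/\ c ∘ c = c, reflection c a = b &
    forall f, f ∘ f = f -> f ∘ a = 0 -> f ∘ b = 0 -> reflection c f = f].
Proof.
move=> aP bP.
suff [c [cc cab cf]] : exists c, [/\ c ∘ c = c, reflection c a = b &
    forall f, f ∘ f = f -> f ∘ a = 0 -> f ∘ b = 0 -> f ∘ c = 0].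
  exists c; split=> // f ff fa fb; rewrite /reflection (jmulC J c f) cf //.
  by rewrite jmulx0 scaler0 subrr add0r.
have [[_ aa] _] := aP; have [[_ bb] _] := bP.
have [ab0|ab0] := eqVneq ⟨a, b⟩ 0.
  have [c [z [cc cab abz cE]]] := exchange_orth aP bP ab0.
  exists c; split=> // f ff fa fb; have abf : (a + b) ∘ f = 0.
    by rewrite jmulC jmulDr fa fb addr0.
  have ab := idem_orth aa bb ab0.
  have abab : (a + b) ∘ (a + b) = a + b.
    by rewrite !jmulE aa bb (jmulC J b a) ab addr0 add0r.
  rewrite cE jmulZr jmulDr (jmulC J f (a + b)) abf (jmulC J f).
  by rewrite (peirce_10 abab abz abf) addr0 scaler0.
have [c [k [l [cc cab _ _ cE]]]] := exchange_nonorth aP bP ab0.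
exists c; split=> // f ff fa fb.
by rewrite cE jmulDr !jmulZr jmulDr fa fb peirce_00 // addr0 !scaler0 addr0.
Qed.

(** * Jordan frames, eigenvalues and the trace *)

Lemma automorphism_primitive (phi : {linear V -> V}) c :
  jordan_automorphism J phi -> primitive_idempotent J c ->
  primitive_idempotent J (phi c).
Proof.
move=> [[psi phiK psiK] phiM] [[c0 cc] cP].
have idem a : idempotent_elt J (psi a) <-> idempotent_elt J a.
  have inj := can_inj phiK.
  split=> -[a0 aa]; split.
  - by apply: contraNneq a0 => a0; apply/eqP/inj; rewrite psiK a0 linear0.
  - by rewrite -[a in RHS]psiK -aa phiM psiK.
  - by apply: contraNneq a0 => a0; rewrite -(psiK a) a0 linear0.
  - by apply: inj; rewrite phiM psiK.
split; first by apply/idem; rewrite phiK.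
case=> a [b [/idem aP /idem bP cab]]; apply: cP; exists (psi a), (psi b).
by split=> //; apply: (can_inj phiK); rewrite linearD /= !psiK.
Qed.

(** Once the first [m] members agree, a reflection takes [phi (E m)] to [F m]. Both are orthogonal
    to the [F i] with i < m, which therefore stay fixed. *)
Lemma frames_transitive n (E F : 'I_n -> V) :
  jordan_frame J E -> jordan_frame J F ->
  exists phi : {linear V -> V}, jordan_automorphism J phi /\
    forall i, phi (E i) = F i.
Proof.
move=> [EP EO _] [FP FO _].
suff ex m : exists phi : {linear V -> V},
    jordan_automorphism J phi /\ forall i : 'I_n, (i < m)%N -> phi (E i) = F i.
  by have [phi [phiA phiE]] := ex n; exists phi; split=> // i; apply: phiE.
elim: m => [|m [phi [phiA phiE]]].
  by exists idfun; split=> //; split=> //; exists id.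
have [nm|mn] := leqP n m.
  by exists phi; split=> // i _; apply/phiE/(leq_trans (ltn_ord i)).
pose i0 := Ordinal mn.
have aP := automorphism_primitive phiA (EP i0).
have [c [cc cE cF]] := exchange aP (FP i0).
have [[rB _] [phiB phiM]] := (reflection_automorphism cc, phiA).
exists (reflection c \o phi); split.
  split; first exact: bij_comp rB phiB.
  by move=> x y /=; rewrite phiM reflectionM.
move=> i; rewrite ltnS leq_eqVlt /= => /orP[/eqP im|im].
  by rewrite (_ : i = i0) //; apply: val_inj.
have ii0 : i != i0 by rewrite -val_eqE /= ltn_eqF.
rewrite phiE //; apply: cF; last exact: FO.
  by case: (FP i) => -[].
by rewrite -(phiE i im) -phiM EO ?linear0.
Qed.

Lemma primitive_norm_exists :
  exists2 N, 0 < N & forall g, primitive_idempotent J g -> ⟨g, g⟩ = N.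
Proof.
have [x x0] := Jsimple.1.
have e0 : 'e != 0 by apply: contraNneq x0 => e0; rewrite -[x]jmul1x e0 jmul0x.
have [g [gP _ _]] := idem_primitive_below (conj e0 (jmul1x 'e)).
exists ⟨g, g⟩; first exact: idem_norm_gt0 gP.1.
by move=> h hP; apply: simple_primitive_norm.
Qed.

End Simple.

Lemma frame_idem n (E : 'I_n -> V) i : jordan_frame J E -> E i ∘ E i = E i.
Proof. by case=> EP _ _; case: (EP i) => -[]. Qed.

Lemma frame_ip1 n (E : 'I_n -> V) i : jordan_frame J E ->
  ⟨E i, 'e⟩ = ⟨E i, E i⟩.
Proof.
by move=> EF; rewrite -{1}(frame_idem i EF) jmul_self_adjoint jmulx1.
Qed.

Lemma frame_ip0 n (E : 'I_n -> V) i j : jordan_frame J E -> i != j ->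
  ⟨E i, E j⟩ = 0.
Proof.
move=> EF ij; rewrite -(frame_idem j EF) -jmul_self_adjoint.
by case: EF => _ -> //; rewrite ip0x.
Qed.

Lemma spectral_jmul n x q (E : 'I_n -> V) i :
  spectral_decomposition J x q E -> x ∘ E i = q i *: E i.
Proof.
move=> [EF ->]; rewrite jmul_suml (bigD1 i) //= jmulZl frame_idem //.
rewrite big1 ?addr0 // => j ji; case: EF => _ EO _.
by rewrite jmulZl EO // scaler0.
Qed.

Lemma spectral_square n x q (E : 'I_n -> V) : spectral_decomposition J x q E ->
  x ∘ x = \sum_i (q i ^+ 2) *: E i.
Proof.
move=> xE; have [_ {2}->] := xE; rewrite linear_sum; apply: eq_bigr => i _.
by rewrite linearZ /= (spectral_jmul i xE) scalerA.
Qed.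

Section Trace.
Context (N : R) (N0 : 0 < N).
Context (primN : forall g, primitive_idempotent J g -> ⟨g, g⟩ = N).

Lemma frame_norm n (E : 'I_n -> V) i : jordan_frame J E -> ⟨E i, E i⟩ = N.
Proof. by case=> EP _ _; apply: primN. Qed.

(** Expresses the number of members through ⟨e, e⟩ and [N], so that all frames have the same
    size. *)
Lemma frame_size n (E : 'I_n -> V) : jordan_frame J E -> ⟨'e, 'e⟩ = n%:R * N.
Proof.
move=> EF; have [_ _ {1}<-] := EF; rewrite ip_suml.
under eq_bigr do rewrite frame_ip1 // frame_norm //.
by rewrite sumr_const card_ord mulr_natl.
Qed.

Lemma spectral_exists n x : has_rank J n ->
  exists (r : 'I_n -> R) (E : 'I_n -> V), spectral_decomposition J x r E.
Proof.
move=> [F FF]; have [s [sP sO se sx]] := spectral_seq (jmul1x 'e) (jmul1x x).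
pose E (i : 'I_(size s)) := (nth (0, 0) s i).2.
have EF : jordan_frame J E.
  split.
  - by move=> i; have [] := sP (nth (0, 0) s i) (mem_nth _ (ltn_ord i)).
  - move=> i j; have /pairwiseP P := sO.
    have P' (k l : 'I_(size s)) : (k < l)%N -> E k ∘ E l = 0.
      by move=> kl; apply/eqP/(P (0, 0)); rewrite ?inE.
    rewrite -val_eqE neq_ltn => /orP[/P'//|ji].
    by rewrite jmulC P'.
  - by rewrite -[RHS]se (big_nth (0, 0)) big_mkord.
have sn : size s = n.
  apply/eqP; rewrite -(eqr_nat R); apply/eqP/(mulIf (lt0r_neq0 N0)).
  by rewrite -(frame_size EF) (frame_size FF).
case: n / sn F FF => _ _; exists (fun i => (nth (0, 0) s i).1), E; split=> //.
by rewrite -sx (big_nth (0, 0)) big_mkord.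
Qed.

Lemma spectral_ip n x q (E : 'I_n -> V) i : spectral_decomposition J x q E ->
  ⟨x, E i⟩ = q i * N.
Proof.
move=> xE; have [EF _] := xE.
rewrite -(frame_idem i EF) -jmul_self_adjoint (spectral_jmul i xE) ipZl.
by rewrite frame_norm.
Qed.

(* [⟨E i, F j⟩] vanishes unless [q i = r j], and has all row and column sums equal to
   [N]; so [q] and [r] take every value equally often. *)
Lemma spectral_perm n x (q r : 'I_n -> R) (E F : 'I_n -> V) :
  spectral_decomposition J x q E -> spectral_decomposition J x r F ->
  perm_eq [tuple q i | i < n] [tuple r i | i < n].
Proof.
move=> xE xF; have [[EF _] [FF _]] := (xE, xF).
apply/seq.permP => P; apply/eqP; rewrite -(eqr_nat R); apply/eqP/(mulIf (lt0r_neq0 N0)).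
have cnt (t : 'I_n -> R) : (count P [tuple t i | i < n])%:R * N = \sum_(i | P (t i)) N.
  rewrite -sum1_count natr_sum /= big_map big_enum_cond /= mulr_suml.
  by apply: eq_bigr => i _; rewrite mul1r.
have qr i j : ⟨E i, F j⟩ != 0 -> q i = r j.
  move=> /mulIf; apply; rewrite -!ipZl -(spectral_jmul i xE) jmulC jmul_self_adjoint.
  by rewrite (spectral_jmul j xF) ipZr ipZl.
have rowE i : N = \sum_j ⟨E i, F j⟩.
  by have [_ _ FE] := FF; rewrite -ip_sumr FE frame_ip1 // frame_norm.
have colE j : N = \sum_i ⟨E i, F j⟩.
  by have [_ _ FE] := EF; rewrite -ip_suml FE jinnerC frame_ip1 // frame_norm.
rewrite !cnt (eq_bigr _ (fun i _ => rowE i)) [RHS](eq_bigr _ (fun i _ => colE i)).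
rewrite [RHS]exchange_big /= big_mkcond; apply: eq_bigr => i _.
rewrite [RHS]big_mkcond /=; case: ifP => Pq.
  apply: eq_bigr => j _.
  by have [->|/qr <-] := eqVneq ⟨E i, F j⟩ 0; rewrite ?Pq ?if_same.
apply/esym/big1 => j _.
by have [->|/qr <-] := eqVneq ⟨E i, F j⟩ 0; rewrite ?Pq ?if_same.
Qed.

(** The set under [xget] contains the sorted coefficients, with [E] permuted accordingly, and by
    [spectral_perm] nothing else. *)
Lemma eigenvaluesE n x q (E : 'I_n -> V) : spectral_decomposition J x q E ->
  eigenvalues J n x = decreasing_rearrangement [tuple q i | i < n].
Proof.
move=> xE; set t := [tuple q i | i < n].
rewrite /eigenvalues; case: xgetP => [l _ [l_sorted [F xF]]|/(_ (decreasing_rearrangement t))].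
  apply/val_inj/(sorted_eq (@geR_trans R) (@geR_anti R)) => //=.
    exact: decreasing_rearrangement_sorted.
  rewrite perm_sym perm_sort perm_sym; have := spectral_perm xF xE.
  by congr perm_eq; apply/(congr1 val)/eq_from_tnth => i; rewrite tnth_mktuple.
case; split; first exact: decreasing_rearrangement_sorted.
have /tuple_permP[p tp] : perm_eq (decreasing_rearrangement t) t by rewrite perm_sort.
have {}tp i : tnth (decreasing_rearrangement t) i = q (p i).
  by rewrite (tnth_nth 0) tp -tnth_nth !tnth_mktuple.
have [[EP EO Ee] xs] := xE; exists (E \o p); split.
  split=> [i|i j ij|]; [exact: EP|by apply: EO; rewrite (inj_eq perm_inj)|].
  by rewrite -Ee [RHS](reindex_inj (@perm_inj _ p)).
rewrite xs (reindex_inj (@perm_inj _ p)) /=.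
by apply: eq_bigr => i _; rewrite tp.
Qed.

Lemma jtraceE n x : has_rank J n -> jtrace J n x * N = ⟨x, 'e⟩.
Proof.
move=> /(spectral_exists x)[r [E xE]]; have [EF xs] := xE.
rewrite /jtrace (eigenvaluesE xE) (sum_decreasing_rearrangement _ id) mulr_suml.
rewrite xs ip_suml; apply: eq_bigr => i _.
by rewrite tnth_mktuple ipZl frame_ip1 // frame_norm.
Qed.

Lemma cone_ip_idem_ge0 x c : in_cone J x -> c ∘ c = c -> 0 <= ⟨x, c⟩.
Proof. by move=> [y ->]; exact: ip_idem_ge0. Qed.

(** One half of the self-duality of the cone: a square is a nonnegative combination of
    idempotents. *)
Lemma cone_ip_ge0 n x y : has_rank J n -> in_cone J x -> 0 <= ⟨x, y ∘ y⟩.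
Proof.
move=> /(spectral_exists y)[r [E yE]] xK.
rewrite (spectral_square yE) ip_sumr sumr_ge0 // => i _.
rewrite ipZr mulr_ge0 ?sqr_ge0 // cone_ip_idem_ge0 //.
exact: frame_idem yE.1.
Qed.

Lemma cone_orth n x c : has_rank J n -> in_cone J x -> c ∘ c = c ->
  ⟨x, c⟩ = 0 -> x ∘ c = 0.
Proof.
move=> Jn xK cc xc; apply/eqP; rewrite -ip_eq0 jmul_self_adjoint.
rewrite (@psd_form_orth (jinner J x) c) ?cc //.
- by move=> k u v; rewrite /= ipDr ipZr.
- by move=> z; apply: cone_ip_ge0 Jn xK.
Qed.

Lemma jtrace_frame n x (F : 'I_n -> V) : jordan_frame J F ->
  jtrace J n x = \sum_i ⟨x, F i⟩ / N.
Proof.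
move=> FF; apply: (mulIf (lt0r_neq0 N0)); rewrite jtraceE; last by exists F.
by have [_ _ <-] := FF; rewrite ip_sumr mulr_suml; apply: eq_bigr => i _;
   rewrite divfK // lt0r_neq0.
Qed.

(** Weak majorization by [e] bounds the largest eigenvalue by 1, so e - x is a nonnegative
    combination of idempotents. *)
Lemma ip_le_eigenvalues_le1 n x g : has_rank J n -> g ∘ g = g ->
  jweakly_majorized J n x 'e -> ⟨x, g⟩ <= ⟨'e, g⟩.
Proof.
move=> Jn gg xmaj; have [q [F xF]] := spectral_exists x Jn.
have [FF xs] := xF; have [_ _ Fe] := FF.
have eF : spectral_decomposition J 'e (fun=> 1) F.
  by split=> //; rewrite -Fe; apply: eq_bigr => i _; rewrite scale1r.
move: xmaj; rewrite /jweakly_majorized (eigenvaluesE xF) (eigenvaluesE eF).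
move=> /(weakly_majorized_max (M := 1)) q1.
have {}q1 i : q i <= 1.
  have /tnthP[j ->] : q i \in decreasing_rearrangement [tuple q i | i < n].
    by rewrite mem_sort; apply/mapP; exists i; rewrite ?mem_enum.
  apply: q1 => l.
  have : tnth (decreasing_rearrangement [tuple 1 : R | _ < n]) l \in [tuple 1 : R | _ < n].
    by rewrite -(mem_sort (fun a b : R => b <= a)) mem_tnth.
  by case/mapP => ? _ ->.
rewrite xs -Fe !ip_suml; apply: ler_sum => i _; rewrite ipZl.
rewrite -[X in _ <= X]mul1r ler_wpM2r // -(frame_idem i FF).
exact: ip_idem_ge0.
Qed.

(** * The positive map *)

Section PositiveMap.
Context (n : nat) (Jn : has_rank J n) (T : {linear V -> V}).
Context (T_pos : positive_map J T) (p : V) (r : 'I_n -> R) (E : 'I_n -> V).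
Context (pE : spectral_decomposition J p r E).
Context (r_pos : forall i, 0 < r i) (r_distinct : injective r).
Context (Te_maj : jweakly_majorized J n (T 'e) 'e).
Context (p_maj : jweakly_majorized J n p (T p)).
Context (Tp2_maj : jweakly_majorized J n (T (p ∘ p)) (p ∘ p)).

(* With [F] a frame diagonalizing [T p], the numbers [⟨T (E j), F i⟩ / N] form a
   substochastic matrix, which the majorizations force to be a permutation matrix. *)
Lemma positive_map_frame :
  exists2 G : 'I_n -> V, jordan_frame J G & forall i, T (E i) = G i.
Proof.
have [q [F TpF]] := spectral_exists (T p) Jn.
have [EF ps] := pE; have [FF Tps] := TpF; have [_ _ Ee] := EF; have [FP _ Fe] := FF.
have N_neq0 : N != 0 by apply: lt0r_neq0.
pose a i j := ⟨T (E j), F i⟩ / N.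
have a_ge0 i j : 0 <= a i j.
  rewrite divr_ge0 ?(ltW N0) ?cone_ip_idem_ge0 ?frame_idem //.
  by apply: T_pos; exists (E j); rewrite frame_idem.
have row_le1 i : \sum_j a i j <= 1.
  rewrite -mulr_suml -ip_suml -linear_sum Ee ler_pdivrMr // mul1r.
  apply: le_trans (ip_le_eigenvalues_le1 Jn (frame_idem i FF) Te_maj) _.
  by rewrite jinnerC frame_ip1 // frame_norm.
have ip_T i (k : 'I_n -> R) :
    ⟨T (\sum_j k j *: E j), F i⟩ / N = \sum_j a i j * k j.
  rewrite linear_sum ip_suml mulr_suml; apply: eq_bigr => j _.
  by rewrite linearZ /= ipZl -mulrA mulrC.
have qE i : q i = \sum_j a i j * r j.
  by rewrite -ip_T -ps (spectral_ip i TpF) mulfK.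
pose s i := \sum_j a i j * r j ^+ 2.
(* The variance of [r] with weights [a i], corrected because the weights may sum to less than 1. *)
have varE i : \sum_j a i j * (r j - q i) ^+ 2 =
    s i - q i ^+ 2 - q i ^+ 2 * (1 - \sum_j a i j).
  rewrite mulrBr mulr1 opprB.
  have -> : s i - q i ^+ 2 + (q i ^+ 2 * (\sum_j a i j) - q i ^+ 2) =
      s i - 2 * q i * \sum_j a i j * r j + q i ^+ 2 * (\sum_j a i j).
    by rewrite -qE; ring.
  rewrite !mulr_sumr -sumrB -big_split; apply: eq_bigr => j _ /=; ring.
have var_ge0 i : 0 <= \sum_j a i j * (r j - q i) ^+ 2.
  by apply: sumr_ge0 => j _; rewrite mulr_ge0 ?sqr_ge0.
have defect_ge0 i : 0 <= q i ^+ 2 * (1 - \sum_j a i j).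
  by rewrite mulr_ge0 ?sqr_ge0 // subr_ge0.
have sum_s : \sum_i s i <= \sum_i r i ^+ 2.
  have := weakly_majorized_sum Tp2_maj.
  rewrite -/(jtrace J n (T (p ∘ p))) -/(jtrace J n (p ∘ p)).
  rewrite (jtrace_frame _ FF) (jtrace_frame _ EF) (spectral_square pE).
  under eq_bigr do rewrite ip_T.
  have p2E : spectral_decomposition J (\sum_i r i ^+ 2 *: E i) (fun i => r i ^+ 2) E by [].
  by under [X in _ <= X]eq_bigr do rewrite (spectral_ip _ p2E) mulfK //.
have q2_le_s i : q i ^+ 2 <= s i.
  by have := var_ge0 i; have := defect_ge0 i; rewrite varE; lra.
have sum_q : \sum_i q i ^+ 2 <= \sum_i r i ^+ 2.
  by apply: le_trans sum_s; apply: ler_sum.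
(* [p_maj] and [sum_q] are the two hypotheses of the rigidity lemma [weakly_majorized_sqr_eq]. *)
have drE : decreasing_rearrangement [tuple r i | i < n] =
    decreasing_rearrangement [tuple q i | i < n].
  move: p_maj; rewrite /jweakly_majorized (eigenvaluesE pE) (eigenvaluesE TpF) => pq.
  apply: weakly_majorized_sqr_eq pq _; rewrite ?decreasing_rearrangement_sorted //.
    move=> i; have : tnth (decreasing_rearrangement [tuple r i | i < n]) i \in [tuple r i | i < n].
      by rewrite -(mem_sort (fun a b : R => b <= a)) mem_tnth.
    by case/mapP => j _ ->; apply: ltW.
  rewrite !(sum_decreasing_rearrangement _ (fun x : R => x ^+ 2)).
  by under eq_bigr do rewrite tnth_mktuple; under [X in _ <= X]eq_bigr do rewrite tnth_mktuple.
have [sigma qr] : exists sigma : 'S_n, forall i, q i = r (sigma i).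
  have : perm_eq [tuple q i | i < n] [tuple r i | i < n].
    apply: (@perm_trans _ (decreasing_rearrangement [tuple q i | i < n])).
      by rewrite perm_sym perm_sort.
    by rewrite -drE perm_sort.
  move=> /tuple_permP[sigma qs]; exists sigma => i.
  have := congr1 (fun l : seq R => nth 0 l i) qs.
  by rewrite -!tnth_nth !tnth_mktuple.
have sum_qr : \sum_i q i ^+ 2 = \sum_i r i ^+ 2.
  by rewrite [RHS](reindex_inj (@perm_inj _ sigma)); apply: eq_bigr => i _; rewrite qr.
(* The terms s_i - q_i^2 are nonnegative while their sum is at most 0. *)
have s_eq i : s i = q i ^+ 2.
  apply/eqP; rewrite -subr_eq0; apply/eqP.
  apply: (psumr_eq0P (F := fun i => s i - q i ^+ 2) (P := predT)) => //.
    by move=> j _; rewrite subr_ge0.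
  apply: le_anti; rewrite sumr_ge0 ?andbT => [|j _]; last by rewrite subr_ge0.
  by rewrite sumrB sum_qr subr_le0.
have var0 i : \sum_j a i j * (r j - q i) ^+ 2 = 0.
  have := varE i; rewrite s_eq subrr sub0r => v.
  by apply: le_anti; rewrite var_ge0 andbT v oppr_le0.
have a0 i j : j != sigma i -> a i j = 0.
  move=> jsi; have := psumr_eq0P _ (var0 i) (i := j) isT.
  move=> /(_ (fun j _ => mulr_ge0 (a_ge0 i j) (sqr_ge0 _)))/eqP.
  rewrite mulf_eq0 sqrf_eq0 subr_eq0 qr (inj_eq r_distinct) (negPf jsi) orbF.
  by move/eqP.
have a1 i : a i (sigma i) = 1.
  have q_neq0 : q i != 0 by rewrite qr lt0r_neq0.
  have := qE i; rewrite (bigD1 (sigma i)) //= big1 => [|j ji]; last by rewrite a0 ?mul0r.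
  by rewrite addr0 -qr -{1}[q i]mul1r => /(mulIf q_neq0).
exists (F \o (sigma^-1)%g) => [|j].
  split=> [i|i j ij|]; first exact: FP.
    by case: FF => _ FO _; apply: FO; rewrite (inj_eq perm_inj).
  by rewrite -Fe [RHS](reindex_inj (@perm_inj _ (sigma^-1)%g)).
rewrite /=; set i0 := (sigma^-1)%g j.
have ji0 : j = sigma i0 by rewrite permKV.
have TEK : in_cone J (T (E j)) by apply: T_pos; exists (E j); rewrite frame_idem.
have orth i : i != i0 -> T (E j) ∘ F i = 0.
  move=> ii0; apply: (cone_orth Jn TEK); first exact: frame_idem.
  have := a0 i j; rewrite ji0 (inj_eq perm_inj) eq_sym => /(_ ii0)/eqP.
  by rewrite mulf_eq0 invr_eq0 (negPf N_neq0) orbF -ji0 => /eqP.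
(* Multiplying [T (E j)] by e = sum of the [F i] leaves only the term at [i0], so [T (E j)] lies in
   the line V_1(F i0). *)
have [k Tk] : exists k, T (E j) = k *: F i0.
  apply: primitive_line (FP i0) _.
  by rewrite jmulC -[RHS](jmulx1 J) -Fe linear_sum (bigD1 i0) //= big1 ?addr0.
have := a1 i0; rewrite -ji0 /a Tk ipZl frame_norm // mulfK // => ->.
by rewrite scale1r.
Qed.

End PositiveMap.

(* The functional [⟨T _, G i⟩] is positive and kills [E j] for [j != i], so it factors
   through the compression to [V_1(E i)]. *)
Lemma positive_map_frame_ip n (T : {linear V -> V}) (E G : 'I_n -> V) x i :
  positive_map J T -> jordan_frame J E -> jordan_frame J G ->
  (forall i, T (E i) = G i) -> ⟨T x, G i⟩ = ⟨x, E i⟩.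
Proof.
move=> T_pos EF GF TE; have [EP _ Ee] := EF.
have kill y j : j != i -> ⟨T (E j ∘ y), G i⟩ = 0.
  move=> ji; apply: (@psd_form_orth (fun u => ⟨T u, G i⟩) (E j)).
  - by move=> k u v /=; rewrite linearP ipDl ipZl.
  - move=> z; apply: cone_ip_idem_ge0; last exact: frame_idem GF.
    by apply: T_pos; exists z.
  - by rewrite frame_idem // TE frame_ip0.
have compress y : ⟨T y, G i⟩ = ⟨T (E i ∘ y), G i⟩.
  rewrite -{1}[y]jmul1x -Ee jmul_suml linear_sum ip_suml (bigD1 i) //=.
  by rewrite big1 ?addr0 // => j /kill.
(* By [compress] the functional takes the same value at [x], [E i ∘ x] and [E i ∘ (E i ∘ x)], so the
   left side is (2 - 1) times that value. *)
have := congr1 (fun u => ⟨T u, G i⟩) (primitive_quadratic x (EP i)).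
rewrite linearB !linearZ /= !ipE -!compress TE !frame_norm //.
rewrite divfK ?lt0r_neq0 // => <-; lra.
Qed.

End Trace.

End EuclideanJordanAlgebra.

(** * Conclusions (a), (b) and (c) from the image frame *)

Theorem theorem5p2 (R : realType) (V : vectType R)
    (J : euclidean_jordan_algebra V) (n : nat)
    (J_simple : simple_EJA J) (J_rank : has_rank J n)
    (T : {linear V -> V}) (T_pos : positive_map J T)
    (p : V) (r : 'I_n -> R) (E : 'I_n -> V)
    (p_spectral : spectral_decomposition J p r E)
    (r_pos : forall i, 0 < r i) (r_distinct : injective r)
    (Te_maj : jweakly_majorized J n (T (jone J)) (jone J))
    (p_maj : jweakly_majorized J n p (T p))
    (Tp2_maj : jweakly_majorized J n (T (jmul J p p)) (jmul J p p))
    (T_comm : operator_commute J (T p) (T (jmul J p p))) :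
  [/\ exists phi : {linear V -> V}, jordan_automorphism J phi /\
        forall x, x \in <<[tuple E i | i < n]>>%VS -> T x = phi x,
      forall x, x \in <<[tuple E i | i < n]>>%VS ->
        eigenvalues J n (T x) = eigenvalues J n x &
      doubly_stochastic J n T].
Proof.
have [N N_gt0 primN] := primitive_norm_exists J_simple.
have [G G_frame TE] := positive_map_frame N_gt0 primN J_rank T_pos p_spectral
  r_pos r_distinct Te_maj p_maj Tp2_maj.
have [E_frame _] := p_spectral.
have TsumE (k : 'I_n -> R) : T (\sum_i k i *: E i) = \sum_i k i *: G i.
  by rewrite linear_sum; apply: eq_bigr => i _; rewrite linearZ /= TE.
split.
- have [phi [phi_aut phiE]] := frames_transitive J_simple E_frame G_frame.
  exists phi; split=> // x /(mem_span_tuple (E := E))[k ->].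
  by rewrite TsumE linear_sum; apply: eq_bigr => i _; rewrite linearZ /= phiE.
- move=> x /(mem_span_tuple (E := E))[k ->].
  (* [x] and [T x] have the same coefficients [k], in the frames [E] and [G]. *)
  rewrite (eigenvaluesE N_gt0 primN (conj E_frame erefl)).
  by rewrite (eigenvaluesE N_gt0 primN (conj G_frame (TsumE k))).
split=> // [|x].
  have [[_ _ Ee] [_ _ Ge]] := (E_frame, G_frame).
  by rewrite /unital_map -{1}Ee linear_sum -Ge; apply: eq_bigr => i _; apply: TE.
(* The trace of [T x] is computed in [G] and that of [x] in [E], so that the two sums agree term by
   term. *)
rewrite (jtrace_frame N_gt0 primN _ G_frame) (jtrace_frame N_gt0 primN _ E_frame).
apply: eq_bigr => i _.
by rewrite (positive_map_frame_ip N_gt0 primN _ _ T_pos E_frame G_frame).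
Qed.
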